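(* $M(\mathbb{Z}/2\mathbb{Z}\oplus\mathbb{Z}/12\mathbb{Z})=K_1$, where $K_1=\mathbb{Q}(\alpha_1)$ with $\alpha_1$ a root of $x^3-x^2+1$ (discriminant $-23$).
   Context: For a finite abelian group $G$, $M(G)$ denotes the cubic number field $K$ (up to isomorphism) with smallest absolute value $|\Delta(K)|$ of its discriminant such that there exists an elliptic curve $E$ over $K$ with $E(K)_{\mathrm{tors}}\simeq G$. *)

(* Defs.v *)
From HB Require Import structures.
From mathcomp Require Import all_boot all_order all_algebra all_field.
From mathcomp Require Import classical_sets.
From mathcomp Require Import ring.
Set Implicit Arguments.
Unset Strict Implicit.
Unset Printing Implicit Defensive.
Import GRing.Theory.
Local Open Scope ring_scope.

HB.instance Definition _ (U V : finZmodType) := GRing.Zmodule.on (U * V)%type.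

(** Elliptic curves are given by long Weierstrass equations
      y^2 + a1 x y + a3 y = x^3 + a2 x^2 + a4 x + a6
    of nonzero discriminant, with the usual invariants b2, b4, b6, b8. *)
Section EllipticCurve.
Variable F : fieldType.

Record weierstrass :=
  Weierstrass { wa1 : F; wa2 : F; wa3 : F; wa4 : F; wa6 : F }.

Implicit Type W : weierstrass.

Definition wb2 W := wa1 W ^+ 2 + 4 * wa2 W.
Definition wb4 W := 2 * wa4 W + wa1 W * wa3 W.
Definition wb6 W := wa3 W ^+ 2 + 4 * wa6 W.
Definition wb8 W :=
  wa1 W ^+ 2 * wa6 W + 4 * wa2 W * wa6 W - wa1 W * wa3 W * wa4 W
    + wa2 W * wa3 W ^+ 2 - wa4 W ^+ 2.
Definition wdisc W :=
  - (wb2 W ^+ 2 * wb8 W) - 8 * wb4 W ^+ 3 - 27 * wb6 W ^+ 2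
    + 9 * wb2 W * wb4 W * wb6 W.

Record elliptic_curve := EllipticCurve {
  ec_eqn :> weierstrass;
  ec_smooth : wdisc ec_eqn != 0
}.

(** Points in affine coordinates, [None] being the point at infinity. *)
Definition on_curve W (P : option (F * F)) : bool :=
  if P is Some (x, y) then
    y ^+ 2 + wa1 W * x * y + wa3 W * y
      == x ^+ 3 + wa2 W * x ^+ 2 + wa4 W * x + wa6 W
  else true.

(** Slope of the line through two points, of the tangent if they coincide. *)
Definition line_slope W (x1 y1 x2 y2 : F) : F :=
  if x1 == x2
  then (3 * x1 ^+ 2 + 2 * wa2 W * x1 + wa4 W - wa1 W * y1)
         / (2 * y1 + wa1 W * x1 + wa3 W)
  else (y2 - y1) / (x2 - x1).

(** The chord-tangent law; the test selects the opposite points, as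
    - (x, y) = (x, - y - a1 x - a3). *)
Definition add_coord W (P Q : option (F * F)) : option (F * F) :=
  match P, Q with
  | None, _ => Q
  | _, None => P
  | Some (x1, y1), Some (x2, y2) =>
      if (x1 == x2) && (y1 + y2 + wa1 W * x2 + wa3 W == 0) then None
      else
        let l := line_slope W x1 y1 x2 y2 in
        let x3 := l ^+ 2 + wa1 W * l - wa2 W - x1 - x2 in
        Some (x3, l * (x1 - x3) - y1 - wa1 W * x3 - wa3 W)
  end.

Lemma add_coord_on_curve W (P Q : option (F * F)) :
  on_curve W P -> on_curve W Q -> on_curve W (add_coord W P Q).
Proof.
case: P => [[x1 y1]|] //; case: Q => [[x2 y2]|] //=.
case: W => a1 a2 a3 a4 a6 /= /eqP e1 /eqP e2; case: ifPn => //=.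
rewrite /line_slope /= => nopp; set l := (if _ then _ else _).
set x3 := l ^+ 2 + _ - _ - _ - _.
have A0 : a4 - 2 * l * (y1 - l * x1) - a1 * (y1 - l * x1) - a3 * l
          - x1 * x2 - x3 * (x1 + x2) = 0.
  rewrite /x3 /l; case: eqVneq nopp => [ex /=|nx _].
    subst x2 => nopp.
    have ey : y1 = y2.
      apply/eqP; rewrite -subr_eq0.
      suff : (y1 - y2) * (y1 + y2 + a1 * x1 + a3) == 0.
        by rewrite mulf_eq0 (negPf nopp) orbF.
      apply/eqP.
      transitivity (y1 ^+ 2 + a1 * x1 * y1 + a3 * y1
                    - (y2 ^+ 2 + a1 * x1 * y2 + a3 * y2)); first by ring.
      by rewrite e1 e2 subrr.
    subst y2.
    have dn0 : 2 * y1 + a1 * x1 + a3 != 0.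
      by move: nopp; congr (_ != 0); ring.
    set n := 3 * _ + _ + _ - _; set d := 2 * y1 + _ + _.
    transitivity (n - n / d * d); last by rewrite mulfVK ?subrr.
    rewrite /n /d; ring.
  have dn0 : x2 - x1 != 0 by rewrite subr_eq0 eq_sym.
  apply: (mulIf dn0); rewrite mul0r.
  set k := (y2 - y1) / (x2 - x1).
  have ek : y2 = y1 + k * (x2 - x1) by rewrite mulfVK // addrC subrK.
  transitivity ((y1 ^+ 2 + a1 * x1 * y1 + a3 * y1
                  - (x1 ^+ 3 + a2 * x1 ^+ 2 + a4 * x1 + a6))
                - (y2 ^+ 2 + a1 * x2 * y2 + a3 * y2
                  - (x2 ^+ 3 + a2 * x2 ^+ 2 + a4 * x2 + a6))).
    by rewrite [in RHS]ek; ring.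
  by rewrite e1 e2 !subrr.
set A := (X in X = 0) in A0.
apply/eqP/eqP; rewrite -subr_eq0; apply/eqP.
transitivity ((y1 ^+ 2 + a1 * x1 * y1 + a3 * y1
                - (x1 ^+ 3 + a2 * x1 ^+ 2 + a4 * x1 + a6))
              + A * (x1 - x3)); last by rewrite e1 A0 subrr mul0r addr0.
clearbody l; rewrite /A /x3; ring.
Qed.

Definition point (E : elliptic_curve) := {P : option (F * F) | on_curve E P}.

Definition point0 (E : elliptic_curve) : point E := exist _ None isT.

Definition point_add (E : elliptic_curve) (P Q : point E) : point E :=
  exist _ (add_coord E (val P) (val Q))
    (add_coord_on_curve (valP P) (valP Q)).

Definition is_torsion (E : elliptic_curve) (P : point E) : Prop :=
  exists2 n : nat, (0 < n)%N & iter n (point_add P) (point0 E) = point0 E.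

Definition torsion_isog (E : elliptic_curve) (G : finZmodType) : Prop :=
  exists f : G -> point E,
    [/\ injective f,
        {morph f : u v / u + v >-> point_add u v}
      & forall P : point E, is_torsion P <-> exists u : G, f u = P].

End EllipticCurve.

Section NumberField.
Variable K : fieldExtType rat.
Local Notation n := (\dim {:K}).

Definition field_trace (x : K) : rat :=
  let e := vbasis {:K} in \tr (passmx.mxof e e (amull x)).

Definition integral_basis (b : n.-tuple K) : Prop :=
  basis_of {:K} b /\
  forall x : K, integralOver (intr : int -> K) x <->
    exists c : 'I_n -> int, x = \sum_(i < n) tnth b i *~ c i.

Definition basis_disc (b : n.-tuple K) : rat :=
  \det (\matrix_(i < n, j < n) field_trace (tnth b i * tnth b j)).

(** The determinant does not depend on the choice of an integral basis; the
    default value 0 is never reached, as every number field has one. *)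
Definition field_disc : rat :=
  xget 0 (fun d : rat =>
    exists2 b : n.-tuple K, integral_basis b & d = basis_disc b).

End NumberField.

Definition field_iso (K L : fieldExtType rat) : Prop :=
  exists f : {rmorphism K -> L}, bijective f.

Definition cubic_with_torsion (G : finZmodType) (K : fieldExtType rat) : Prop :=
  \dim {:K} = 3%N /\ exists E : elliptic_curve K, torsion_isog E G.

(** [is_M G K] reads M(G) = K, for fields up to isomorphism. *)
Definition is_M (G : finZmodType) (K : fieldExtType rat) : Prop :=
  cubic_with_torsion G K /\
  forall L : fieldExtType rat, cubic_with_torsion G L ->
    `|field_disc K| <= `|field_disc L| /\
    (`|field_disc L| = `|field_disc K| -> field_iso K L).

(* Main.v *)
(* For the bound on discriminants, the ring of integers of a cubic field is
   encoded by an integral binary cubic form with the same discriminant (Delone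
   and Faddeev).  A form of positive discriminant is reduced through its Hessian
   and a form of negative discriminant through its definite quadratic factor
   over the real algebraic numbers.  When [|disc| <= 23] the first reduction is
   contradictory, while the second yields a monic cubic from a short list, all
   of whose irreducible members define the field of discriminant -23.

   For the torsion, an explicit curve over [K1] has independent points of order
   2 and 12.  The prime 3 is inert with residue field of 27 elements, over which
   the curve has 24 points, and the kernel of reduction is torsion free since
   its formal parameter is additive to third order; as the chord-tangent law is
   associative, reduction is injective on torsion points. *)

Require Import Defs.
From HB Require Import structures.
From mathcomp Require Import all_boot all_order all_algebra all_field.
From mathcomp Require boolp classical_sets.
From mathcomp Require Import ring lra zify realalg.
Set Implicit Arguments.
Unset Strict Implicit.
Unset Printing Implicit Defensive.
Import Order.TTheory GRing.Theory Num.Theory.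
Local Open Scope ring_scope.

(** * The group law *)

(** Minimality concerns fields alone: every cubic field has discriminant at least 23 in absolute
    value, and equality yields a root of x^3 - x^2 + 1 in the field, hence an isomorphism with [K1].
    The same lower bound shows that the order generated by [alpha1] is maximal.

    The single prime 3 settles the torsion because the points over its residue field are exactly as
    many as the known torsion points. This requires that the kernel of reduction has no 3-torsion
    either. If the parameter t of P has exact order k >= 1, then 3 t has order k + 1, as 3 is
    unramified, whereas 3 P = 0 would make this order at least 3 k. With an error term of order 2 k
    only, the case k = 1 would not be excluded, which is why additivity is pushed to third order. *)

Section GroupLaw.
Variable F : fieldType.
Implicit Type W : weierstrass F.

(* The line of slope [l] and intercept [n] cuts the curve in points of
   abscissae [x1], [x2], [x3], counted with multiplicity. *)
Definition line_cut W l n x1 x2 x3 :=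
  [/\ x1 + x2 + x3 = l ^+ 2 + wa1 W * l - wa2 W,
      x1 * x2 + x1 * x3 + x2 * x3
        = wa4 W - 2 * l * n - wa1 W * n - wa3 W * l
    & x1 * x2 * x3 = n ^+ 2 + wa3 W * n - wa6 W].

Definition oppy W x y : F := - y - wa1 W * x - wa3 W.

Definition opp_coord W (P : option (F * F)) :=
  if P is Some (x, y) then Some (x, oppy W x y) else None.

Lemma oppyK W x y : oppy W x (oppy W x y) = y.
Proof. rewrite /oppy; ring. Qed.

Lemma opp_coord_on_curve W P : on_curve W P -> on_curve W (opp_coord W P).
Proof.
by case: P => [[x y]|] //= /eqP <-; apply/eqP; rewrite /oppy; ring.
Qed.

Lemma on_curve_eqx W x1 y1 x2 y2 :
  on_curve W (Some (x1, y1)) -> on_curve W (Some (x2, y2)) -> x1 = x2 ->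
  y1 = y2 \/ y1 + y2 + wa1 W * x2 + wa3 W = 0.
Proof.
move=> /eqP e1 /eqP e2 ex; subst x2.
have /eqP : (y1 - y2) * (y1 + y2 + wa1 W * x1 + wa3 W) = 0.
  transitivity ((y1 ^+ 2 + wa1 W * x1 * y1 + wa3 W * y1)
     - (y2 ^+ 2 + wa1 W * x1 * y2 + wa3 W * y2)); first by ring.
  by rewrite e1 e2 subrr.
by rewrite mulf_eq0 subr_eq0 => /orP[] /eqP; [left | right].
Qed.

(** These are Vieta's formulas for the cubic obtained by substituting the line into the equation.
    The sum of the roots defines [x3]. The second relation is the tangent slope, or the difference
    of the two curve equations divided by [x2 - x1]; the third is the curve equation at [x1]. *)
Lemma add_coord_cut W x1 y1 x2 y2 :
    on_curve W (Some (x1, y1)) -> on_curve W (Some (x2, y2)) ->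
    ~~ ((x1 == x2) && (y1 + y2 + wa1 W * x2 + wa3 W == 0)) ->
  exists l n x3, [/\ y1 = l * x1 + n, y2 = l * x2 + n, line_cut W l n x1 x2 x3
   & add_coord W (Some (x1, y1)) (Some (x2, y2))
       = Some (x3, oppy W x3 (l * x3 + n))].
Proof.
move=> c1 c2 nopp; rewrite /add_coord (negPf nopp).
set l := line_slope _ _ _ _ _; set x3 := _ - x2.
have [ey2 e2] : y2 = l * x2 + (y1 - l * x1) /\
    x1 * x2 + x1 * x3 + x2 * x3 = wa4 W - 2 * l * (y1 - l * x1)
      - wa1 W * (y1 - l * x1) - wa3 W * l.
  rewrite /x3 /l /line_slope; case: (eqVneq x1 x2) nopp => [ex|nx] /= nopp.
    have [ey|/eqP e] := on_curve_eqx c1 c2 ex; last by rewrite e in nopp.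
    subst x2 y2; split; first by ring.
    have dn0 : 2 * y1 + wa1 W * x1 + wa3 W != 0.
      by move: nopp; congr (_ != 0); ring.
    apply/eqP; rewrite -subr_eq0; apply/eqP.
    set m := 3 * _ + _ + _ - _; set d := 2 * y1 + _ + _.
    transitivity (m / d * d - m); last by rewrite mulfVK ?subrr.
    by rewrite /m /d; ring.
  have dn0 : x2 - x1 != 0 by rewrite subr_eq0 eq_sym.
  set k := (y2 - y1) / (x2 - x1).
  have ek : y2 = k * x2 + (y1 - k * x1).
    by transitivity (y1 + k * (x2 - x1)); [rewrite mulfVK // addrC subrK|ring].
  split=> //; apply/eqP; rewrite -subr_eq0; apply/eqP; apply: (mulIf dn0).
  rewrite mul0r; move: c1 c2 => /eqP c1 /eqP c2; move: c2;
    rewrite [in LHS]ek => c2.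
  transitivity (((k * x2 + (y1 - k * x1)) ^+ 2 + wa1 W * x2 * (k * x2 + (y1 - k
    * x1))
       + wa3 W * (k * x2 + (y1 - k * x1))
       - (x2 ^+ 3 + wa2 W * x2 ^+ 2 + wa4 W * x2 + wa6 W)) -
    (y1 ^+ 2 + wa1 W * x1 * y1 + wa3 W * y1
       - (x1 ^+ 3 + wa2 W * x1 ^+ 2 + wa4 W * x1 + wa6 W))); first by ring.
  by rewrite c1 c2 !subrr.
exists l, (y1 - l * x1), x3; split=> //; first by ring.
- split=> //; first by rewrite /x3; ring.
  move/eqP: c1 => c1; apply/eqP; rewrite -subr_eq0; apply/eqP.
  transitivity (x1 * (x1 * x2 + x1 * x3 + x2 * x3 - (wa4 W - 2 * l * (y1 - l *
    x1)
      - wa1 W * (y1 - l * x1) - wa3 W * l))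
    - (y1 ^+ 2 + wa1 W * x1 * y1 + wa3 W * y1 -
     (x1 ^+ 3 + wa2 W * x1 ^+ 2 + wa4 W * x1 + wa6 W))).
    rewrite /x3; ring.
  by rewrite e2 c1 !subrr mulr0 subrr.
- by rewrite /oppy; congr (Some (_, _)); ring.
Qed.

(** At a singular point the equation and its two partial derivatives determine [a3], [a4] and [a6],
    and the discriminant then vanishes identically. *)
Lemma smooth_point W x y : wdisc W != 0 -> on_curve W (Some (x, y)) ->
  2 * y + wa1 W * x + wa3 W = 0 ->
  3 * x ^+ 2 + 2 * wa2 W * x + wa4 W - wa1 W * y != 0.
Proof.
case: W => a1 a2 a3 a4 a6 /= nz /eqP c dy; apply: contra nz => /eqP dx.
have e3 : a3 = - 2 * y - a1 * x by apply/eqP; rewrite -subr_eq0 -dy; apply/eqP;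
  ring.
have e4 : a4 = a1 * y - 3 * x ^+ 2 - 2 * a2 * x.
  by apply/eqP; rewrite -subr_eq0 -dx; apply/eqP; ring.
have e6 : a6 = y ^+ 2 + a1 * x * y + a3 * y - x ^+ 3 - a2 * x ^+ 2 - a4 * x.
  by rewrite c; ring.
rewrite /wdisc /wb2 /wb4 /wb6 /wb8 /= e6 e4 e3; apply/eqP; ring.
Qed.

(* Conversely, multiplicities determine the sum: at a double point the line
   must be the tangent, because the curve is smooth there. *)
Lemma cut_add_coord W l n x1 x2 x3 : wdisc W != 0 -> line_cut W l n x1 x2 x3 ->
  add_coord W (Some (x1, l * x1 + n)) (Some (x2, l * x2 + n))
    = Some (x3, oppy W x3 (l * x3 + n)).
Proof.
move=> nz [e1 e2 e3].
have c1 : on_curve W (Some (x1, l * x1 + n)).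
  apply/eqP; apply/eqP; rewrite -subr_eq0; apply/eqP.
  transitivity (- (x1 ^+ 2 * (x1 + x2 + x3 - (l ^+ 2 + wa1 W * l - wa2 W)))
    + x1 * (x1 * x2 + x1 * x3 + x2 * x3 - (wa4 W - 2 * l * n - wa1 W * n - wa3 W
      * l))
    - (x1 * x2 * x3 - (n ^+ 2 + wa3 W * n - wa6 W))); first by ring.
  by rewrite e1 e2 e3 !subrr !mulr0 !oppr0 !addr0.
have ex3 : x3 = l ^+ 2 + wa1 W * l - wa2 W - x1 - x2 by rewrite -e1; ring.
have tan : x1 = x2 -> 3 * x1 ^+ 2 + 2 * wa2 W * x1 + wa4 W - wa1 W * (l * x1 +
  n)
    = l * (2 * (l * x1 + n) + wa1 W * x1 + wa3 W).
  move=> ex; subst x2; apply/eqP; rewrite -subr_eq0; apply/eqP.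
  transitivity (2 * x1 * (x1 + x1 + x3 - (l ^+ 2 + wa1 W * l - wa2 W))
     - (x1 * x1 + x1 * x3 + x1 * x3 - (wa4 W - 2 * l * n - wa1 W * n - wa3 W *
       l))).
    ring.
  by rewrite e1 e2 !subrr mulr0 subrr.
have nopp : x1 = x2 -> 2 * (l * x1 + n) + wa1 W * x1 + wa3 W != 0.
  move=> ex; apply/eqP => d0; have := smooth_point nz c1 d0.
  by rewrite tan // d0 mulr0 eqxx.
rewrite /add_coord; case: ifPn => [/andP[/eqP ex]|_].
  by subst x2 => /eqP o; case/eqP: (nopp erefl); rewrite -o; ring.
have -> : line_slope W x1 (l * x1 + n) x2 (l * x2 + n) = l.
  rewrite /line_slope; case: eqVneq => [ex|nx];
    first by rewrite tan // mulfK // nopp.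
  by field; rewrite subr_eq0 eq_sym.
by rewrite -ex3 /oppy; congr (Some (_, _)); ring.
Qed.

Lemma line_cut_swap W l n x1 x2 x3 :
  line_cut W l n x1 x2 x3 -> line_cut W l n x2 x1 x3.
Proof. by move=> [e1 e2 e3]; split; rewrite -(e1, e2, e3); ring. Qed.

Lemma line_cut_rot W l n x1 x2 x3 :
  line_cut W l n x1 x2 x3 -> line_cut W l n x3 x1 x2.
Proof. by move=> [e1 e2 e3]; split; rewrite -(e1, e2, e3); ring. Qed.

Lemma line_cut_opp W l n x1 x2 x3 : line_cut W l n x1 x2 x3 ->
  line_cut W (- l - wa1 W) (- n - wa3 W) x1 x2 x3.
Proof. by move=> [e1 e2 e3]; split; rewrite (e1, e2, e3); ring. Qed.

Lemma oppy_line W l n x :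
  oppy W x (l * x + n) = (- l - wa1 W) * x + (- n - wa3 W).
Proof. by rewrite /oppy; ring. Qed.

Lemma add_coordC W P Q : on_curve W P -> on_curve W Q ->
  add_coord W P Q = add_coord W Q P.
Proof.
case: P => [[x1 y1]|] c1; case: Q => [[x2 y2]|] c2 //=.
rewrite eq_sym; case: (eqVneq x2 x1) => [ex|nx] /=.
  have [ey|/eqP o] := on_curve_eqx c2 c1 ex; first by subst x2 y2.
  by subst x2; rewrite o (addrC y1) o.
rewrite /line_slope eq_sym (negPf nx).
have dn0 : x2 - x1 != 0 by rewrite subr_eq0.
have dn0' : x1 - x2 != 0 by rewrite subr_eq0 eq_sym.
by congr (Some (_, _)); field; apply/andP.
Qed.

Lemma add_coordN W P : add_coord W P (opp_coord W P) = None.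
Proof.
by case: P => [[x y]|] //=; rewrite eqxx /oppy; case: eqVneq => // /eqP[]; ring.
Qed.

Lemma add_coordNr W P Q : on_curve W P -> on_curve W Q ->
  add_coord W P Q = None -> Q = opp_coord W P.
Proof.
case: P => [[x1 y1]|] c1; case: Q => [[x2 y2]|] c2 //=.
case: ifP => // /andP[/eqP ex /eqP o] _; congr (Some (_, _)); first by [].
by rewrite /oppy ex; apply/eqP; rewrite -subr_eq0 -o; apply/eqP; ring.
Qed.

(** Negation carries the line through P, Q and -(P + Q) to a line through -P, -Q and P + Q, which
    computes the sum of -P and P + Q. *)
Lemma add_coordNK W P Q : wdisc W != 0 -> on_curve W P -> on_curve W Q ->
  add_coord W (opp_coord W P) (add_coord W P Q) = Q.
Proof.
move=> nz cP cQ; have [e|] := eqVneq (add_coord W P Q) None.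
  by rewrite e (add_coordNr cP cQ e) /=; case: (P) => [[]|].
case: P cP => [[x1 y1]|] c1; case: Q cQ => [[x2 y2]|] c2 // ne.
  have [|l [n [x3 [e1 e2 cut ->]]]] := @add_coord_cut W _ _ _ _ c1 c2.
    by apply: contra ne => /= ->.
  have /line_cut_swap cut' := line_cut_rot (line_cut_opp cut).
  have -> : opp_coord W (Some (x1, y1))
      = Some (x1, (- l - wa1 W) * x1 + (- n - wa3 W)).
    by rewrite e1 /opp_coord oppy_line.
  by rewrite oppy_line (cut_add_coord nz cut') e2 -oppy_line oppyK.
rewrite /= eqxx /oppy; case: eqVneq => //= /eqP[]; ring.
Qed.

(* The line through [P + Q] and [R] and the line through [P] and [Q + R] are
   obtained from the lines [Q R] and [P Q], of slopes [m] and [l], by adding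
   the same quantity [(w - u) / (l - m)] to the slope. *)
Lemma line_cut_assoc W xq yq l xp u m xr w : l != m ->
    line_cut W l (yq - l * xq) xq xp u -> line_cut W m (yq - m * xq) xq xr w ->
    let s := m + (w - u) / (l - m) in let n := m * (xr - xq) + yq - s * xr in
    let z := s ^+ 2 + wa1 W * s - wa2 W - u - xr in
  oppy W u (l * u + (yq - l * xq)) = s * u + n /\ line_cut W s n u xr z.
Proof.
case: W => a1 a2 a3 a4 a6; rewrite /line_cut /= => nlm [e1 e2 e3] [f1 f2 f3].
move: nlm; rewrite -subr_eq0; set d := l - m => d0; set e := (w - u) / d.
have -> : l = m + d by rewrite addrC subrK.
have hl : l = m + d by rewrite addrC subrK.
have hw : w = u + e * d by rewrite divfK // addrC subrK.
clearbody d e; subst l w.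
have h2 : a2 = m ^+ 2 + a1 * m - xq - xr - (u + e * d).
  by apply/eqP; rewrite -subr_eq0 -(subrr (xq + xr + (u + e * d))) {2}f1;
    apply/eqP; ring.
subst a2.
have hp : xp = xr + e * d + d * (2 * m + d + a1).
  by apply/eqP; rewrite -subr_eq0 -(subrr (xq + xp + u)) {2}e1; apply/eqP; ring.
subst xp.
have h4 : a4 = xq * xr + xq * (u + e * d) + xr * (u + e * d)
    + 2 * m * (yq - m * xq) + a1 * (yq - m * xq) + a3 * m by rewrite f2; ring.
have h3 : a3 = e * (xr - u) - u * (2 * m + d + a1) + xq * (2 * m + d) - 2 * yq.
  apply: (mulIf d0); apply/eqP; rewrite -subr_eq0; apply/eqP.
  rewrite h4 in e2; move/eqP: e2; rewrite -subr_eq0 => /eqP <-; ring.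
have h6 : a6 = (yq - m * xq) ^+ 2 + a3 * (yq - m * xq) - xq * xr * (u + e * d).
  by rewrite f3; ring.
subst a6 a4 a3; rewrite /oppy /=; split; first by ring.
split; ring.
Qed.

Lemma add_coord_cutN W x1 y1 x2 y2 :
    on_curve W (Some (x1, y1)) -> on_curve W (Some (x2, y2)) ->
    Some (x2, y2) != opp_coord W (Some (x1, y1)) ->
  exists l x3, [/\ y2 = l * x2 + (y1 - l * x1),
     line_cut W l (y1 - l * x1) x1 x2 x3
   & add_coord W (Some (x1, y1)) (Some (x2, y2))
       = Some (x3, oppy W x3 (l * x3 + (y1 - l * x1)))].
Proof.
move=> c1 c2 ne; have [|l [n [x3 [e1 e2 cut ->]]]] := add_coord_cut c1 c2.
  apply: contra ne => o; apply/eqP; apply: add_coordNr => //.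
  by rewrite /add_coord o.
have en : n = y1 - l * x1 by rewrite e1; ring.
by exists l, x3; rewrite -en.
Qed.

(** Away from opposite points, the lines PQ and QR both pass through Q. If their slopes differ,
    [line_cut_assoc] used in both directions describes the outer sums, tangents included. If the
    slopes agree, the two lines coincide and Vieta leaves R = P, where commutativity suffices, or R
    = -(P + Q), where both sides are at infinity. *)
Lemma add_coordA W P Q R : wdisc W != 0 ->
    on_curve W P -> on_curve W Q -> on_curve W R ->
  add_coord W P (add_coord W Q R) = add_coord W (add_coord W P Q) R.
Proof.
move=> nz cP cQ cR.
have [eQ|nPQ] := eqVneq P (opp_coord W Q).
  rewrite eQ add_coordNK // (add_coordC (P := opp_coord W Q))
    ?opp_coord_on_curve //.
  by rewrite add_coordN.
have [eR|nQR] := eqVneq R (opp_coord W Q).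
  rewrite eR add_coordN (add_coordC cP cQ).
  rewrite (add_coordC _ (opp_coord_on_curve cQ)) ?add_coord_on_curve //
    add_coordNK //.
  by case: (P) => [[]|].
case: P Q R cP cQ cR nPQ nQR => [[xp yp]|] [[xq yq]|] [[xr yr]|] // cP cQ cR nPQ
  nQR.
- have [l [u [ep cl el]]] := add_coord_cutN cQ cP nPQ.
  have [m [w [er cm em]]] := add_coord_cutN cQ cR nQR.
  rewrite (add_coordC cP cQ) el em.
  have [elm|nlm] := eqVneq l m; last first.
    have nml : m != l by rewrite eq_sym.
    have [h1 h2] := line_cut_assoc nlm cl cm.
    have [h3 h4] := line_cut_assoc nml cm cl.
    have d0 : l - m != 0 by rewrite subr_eq0.
    have d1 : m - l != 0 by rewrite subr_eq0 eq_sym.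
    have hs : (u - w) / (m - l) = (w - u) / (l - m) by field; apply/andP.
    rewrite hs in h3 h4; move: h1 h2 h3 h4; set e := (w - u) / (l - m) => h1 h2
      h3 h4.
    have he : e * (l - m) = w - u by rewrite divfK.
    rewrite h1 h3 [in Some (xr, _)]er [in Some (xp, _)]ep.
    have -> : m * xr + (yq - m * xq)
        = (m + e) * xr + (m * (xr - xq) + yq - (m + e) * xr) by ring.
    have -> : l * xp + (yq - l * xq)
        = (l + e) * xp + (l * (xp - xq) + yq - (l + e) * xp) by ring.
    rewrite (cut_add_coord nz h2) (cut_add_coord nz (line_cut_swap h4)).
    case: cl cm => [e1 _ _] [f1 _ _].
    have hx : (l - m) * (l + m + wa1 W) = xp + u - xr - w.
      transitivity ((l ^+ 2 + wa1 W * l - wa2 W) - (m ^+ 2 + wa1 W * m - wa2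
        W)).
        by ring.
      by rewrite -e1 -f1; ring.
    have a2E : wa2 W = m ^+ 2 + wa1 W * m - (xq + xr + w) by rewrite f1; ring.
    have hz : (l + e) ^+ 2 + wa1 W * (l + e) - wa2 W - w - xp
        = (m + e) ^+ 2 + wa1 W * (m + e) - wa2 W - u - xr.
      apply/eqP; rewrite -subr_eq0; apply/eqP.
      transitivity ((l - m) * (l + m + wa1 W) + 2 * (e * (l - m)) - w - xp + u +
        xr).
        by ring.
      by rewrite hx he; ring.
    rewrite hz; set z := (m + e) ^+ 2 + _ - _ - _ - _.
    have hzq : z - xq = e * (l - m) + e * (2 * m + e + wa1 W).
      by rewrite /z a2E he; ring.
    suff -> : (l + e) * z + (l * (xp - xq) + yq - (l + e) * xp)
        = (m + e) * z + (m * (xr - xq) + yq - (m + e) * xr) by [].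
    apply/eqP; rewrite -subr_eq0; apply/eqP.
    transitivity ((l - m) * (z - xq) - e * (xp - xr)); first by ring.
    rewrite hzq.
    transitivity (e * ((l - m) * (l + m + wa1 W) + e * (l - m) - (xp - xr))).
      by ring.
    by rewrite hx he; ring.
  subst m; case: (cl) (cm) => [e1 e2 _] [f1 f2 _].
  have s1 : xp + u = xr + w.
    by apply: (addrI xq); rewrite !addrA e1 f1.
  have /eqP : (xr - xp) * (xr - u) = 0.
    transitivity (xq * (xp + u) + xp * u - xq * (xr + w) - xr * w
      + (xr + xq) * (xr + w - (xp + u))); first by ring.
    rewrite -s1 subrr mulr0 addr0; apply/eqP; rewrite -addrA -opprD subr_eq0.
    by apply/eqP; rewrite {2}s1 !mulrDr e2 f2.
  rewrite mulf_eq0 !subr_eq0 => /orP[] /eqP ex; subst xr.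
    have ew : w = u by apply: (addrI xp).
    rewrite ew er -ep add_coordC // -el.
    exact: add_coord_on_curve cQ cP.
  have ew : w = xp by apply: (addrI u); rewrite -s1 addrC.
  have -> : Some (w, oppy W w (l * w + (yq - l * xq))) = opp_coord W (Some (xp,
    yp)).
    by rewrite ew /= [in RHS]ep.
  rewrite add_coordN -er add_coordC //; last first.
    rewrite er -el; exact: add_coord_on_curve cQ cP.
  by rewrite -[Some (u, oppy _ _ _)]/(opp_coord W (Some (u, yr))) add_coordN.
- by rewrite /=; case: (if _ then _ else _) => [[]|].
Qed.

End GroupLaw.

(** * The points as an abelian group *)

Section PointGroup.
Variables (F : fieldType) (E : elliptic_curve F).

HB.instance Definition _ := [Choice of point E by <:].

Definition point_opp (P : point E) : point E :=
  exist _ (opp_coord E (val P)) (opp_coord_on_curve (valP P)).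

Fact point_addA : associative (@point_add F E).
Proof. by move=> P Q R; apply: val_inj; apply: add_coordA (ec_smooth E) (valP P)
  (valP Q) (valP R). Qed.

Fact point_addC : commutative (@point_add F E).
Proof. by move=> P Q; apply: val_inj; apply: add_coordC (valP P) (valP Q). Qed.

Fact point_add0 : left_id (point0 E) (@point_add F E).
Proof. by move=> P; apply: val_inj; case: P => [[[]|]]. Qed.

Fact point_addN : left_inverse (point0 E) point_opp (@point_add F E).
Proof. by move=> P; rewrite point_addC; apply: val_inj; apply: add_coordN. Qed.

HB.instance Definition _ := GRing.isZmodule.Build (point E)
  point_addA point_addC point_add0 point_addN.

Lemma point_addE (P Q : point E) : point_add P Q = P + Q.
Proof. by []. Qed.

Lemma is_torsionE (P : point E) :
  is_torsion P <-> exists2 n : nat, (0 < n)%N & P *+ n = 0.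
Proof.
have iterE n : iter n (point_add P) (point0 E) = P *+ n.
  by elim: n => //= n ->; rewrite mulrS.
by split=> -[n n0 e]; exists n => //; [rewrite -iterE | rewrite iterE].
Qed.

End PointGroup.

(** * Torsion and reduction *)

Lemma leq_add2_mul3 k : (0 < k)%N -> (k.+2 <= 3 * k)%N.
Proof. lia. Qed.

Section KernelOfReduction.
Variables (K : fieldType) (O : subringClosed K) (p : nat).
Hypothesis p_prime : prime p.
Hypothesis pV : (p%:R : K)^-1 \notin O.

(** Order at least [k] at [p]. With [O_inv] and [O_sep] below, [O] is a discrete valuation ring with
    uniformiser [p], so that divisibility by powers of [p] stands for the valuation. *)
Definition val_ge k (x : K) := x / p%:R ^+ k \in O.
Local Notation M := val_ge.

Hypothesis O_inv : forall x, ~~ M 1 x -> x^-1 \in O.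
Hypothesis O_sep : forall x, x != 0 -> exists k, ~~ M k x.

Let p_neq0 : (p%:R : K) != 0.
Proof. by apply: contra pV => /eqP->; rewrite invr0 rpred0. Qed.

Let pX_neq0 k : (p%:R : K) ^+ k != 0.
Proof. exact: expf_neq0. Qed.

Lemma val_ge_0 x : M 0 x = (x \in O).
Proof. by rewrite /M expr0 divr1. Qed.

Lemma val_ge1_N1 : ~~ M 1 1.
Proof. by rewrite /M expr1 mul1r. Qed.

Lemma val_ge_zero k : M k 0.
Proof. by rewrite /M mul0r rpred0. Qed.

Lemma val_geD k x y : M k x -> M k y -> M k (x + y).
Proof. by rewrite /M mulrDl; apply: rpredD. Qed.

Lemma val_geN k x : M k (- x) = M k x.
Proof. by rewrite /M mulNr rpredN. Qed.

Lemma val_geB k x y : M k x -> M k y -> M k (x - y).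
Proof. by move=> hx hy; rewrite val_geD // val_geN. Qed.

Lemma val_geM j k x y : M j x -> M k y -> M (j + k) (x * y).
Proof.
rewrite /M => hx hy; suff -> : x * y / p%:R ^+ (j + k)
  = (x / p%:R ^+ j) * (y / p%:R ^+ k) by apply: rpredM.
by rewrite exprD; field; rewrite !pX_neq0.
Qed.

Lemma val_geMl k x y : x \in O -> M k y -> M k (x * y).
Proof. by rewrite -val_ge_0 => hx hy; apply: (val_geM hx hy). Qed.

Lemma val_geMr k x y : M k x -> y \in O -> M k (x * y).
Proof. by rewrite mulrC => hx hy; apply: val_geMl. Qed.

Lemma val_ge_le j k x : (j <= k)%N -> M k x -> M j x.
Proof.
move=> le; rewrite /M => hx.
suff -> : x / p%:R ^+ j = (x / p%:R ^+ k) * p%:R ^+ (k - j).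
  by rewrite rpredM // rpredX // rpred_nat.
by rewrite -{1}(subnK le) exprD; field; rewrite !pX_neq0.
Qed.

Lemma val_ge_int k x : M k x -> x \in O.
Proof. by rewrite -val_ge_0; apply: val_ge_le. Qed.

Lemma val_geX k n x : M k x -> M (k * n) (x ^+ n).
Proof.
move=> hx; elim: n => [|n IH]; first by rewrite muln0 val_ge_0 rpred1.
by rewrite exprS mulnS val_geM.
Qed.

Lemma val_ge_unit x : ~~ M 1 x -> x \in O -> forall k y, M k (y * x) -> M k y.
Proof.
move=> hx ox k y h; have x0 : x != 0 by apply: contra hx => /eqP ->;
  apply: val_ge_zero.
by rewrite -(mulfK x0 y); apply: val_geMr h _; apply: O_inv.
Qed.

Lemma val_ge1_1D x : M 1 x -> ~~ M 1 (1 + x).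
Proof. by move=> hx; apply: contra val_ge1_N1 => h;
  rewrite -(addrK x 1) val_geB. Qed.

Lemma val_ge1_inv x : x \notin O -> M 1 x^-1.
Proof. by apply: contraR => /O_inv; rewrite invrK. Qed.

Lemma val_exact x : x != 0 -> M 1 x -> exists k, [/\ (0 < k)%N,
  M k x & ~~ M k.+1 x].
Proof.
move=> x0 hx; have [k hk] := O_sep x0.
case: (ex_minnP (ex_intro (fun k => ~~ M k x) k hk)) => m hm mmin.
case: m hm mmin => [|[|m]] hm mmin; first by rewrite (val_ge_le _ hx) in hm.
  by rewrite hx in hm.
by exists m.+1; split=> //; apply: contraT => /mmin; rewrite ltnn.
Qed.

Variable E : elliptic_curve K.
Local Notation a2 := (wa2 E).
Local Notation a4 := (wa4 E).
Local Notation a6 := (wa6 E).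
Hypotheses (a1_0 : wa1 E = 0) (a3_0 : wa3 E = 0).
Hypotheses (a2O : a2 \in O) (a4O : a4 \in O) (a6O : a6 \in O).

Lemma on_curve13 x y : on_curve E (Some (x, y)) ->
  y ^+ 2 = x ^+ 3 + a2 * x ^+ 2 + a4 * x + a6.
Proof. by rewrite /= a1_0 a3_0 !mul0r !addr0 => /eqP. Qed.

Definition in_ker (P : option (K * K)) :=
  if P is Some (x, y) then x \notin O else true.

(* Up to sign, the parameter of the formal group; it vanishes at infinity. *)
Definition tpar (P : option (K * K)) := if P is Some (x, y) then x / y else 0.

(** For non-integral x the equation reads y^2 = x^3 g with g congruent to 1, so t = x / y satisfies
    t^2 g = 1 / x and t^3 g = 1 / y. *)
Lemma ker_param x y : on_curve E (Some (x, y)) -> x \notin O ->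
  [/\ x != 0, y != 0, M 1 (x / y) & exists2 w,
    w \in O & y^-1 = (x / y) ^+ 3 * w].
Proof.
move=> /on_curve13 c nx; have hx := val_ge1_inv nx.
have x0 : x != 0 by apply: contra nx => /eqP->; apply: rpred0.
set g := 1 + (a2 * x^-1 + a4 * x^-1 ^+ 2 + a6 * x^-1 ^+ 3).
have xO := val_ge_int hx.
have gM : M 1 (a2 * x^-1 + a4 * x^-1 ^+ 2 + a6 * x^-1 ^+ 3).
  have hX n : M 1 (x^-1 ^+ n.+1) by rewrite exprS val_geMr // rpredX.
  by apply: val_geD (val_geMl a6O (hX 2)); apply: val_geD (val_geMl a2O hx)
    (val_geMl a4O (hX 1)).
have gO : g \in O by rewrite rpredD ?rpred1 // (val_ge_int gM).
have gu := val_ge1_1D gM; rewrite -/g in gu.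
have g0 : g != 0 by apply: contra gu => /eqP->; apply: val_ge_zero.
have y2 : y ^+ 2 = x ^+ 3 * g by rewrite c /g; field.
have y0 : y != 0.
  have : y ^+ 2 != 0 by rewrite y2 mulf_neq0 // expf_neq0.
  by rewrite expf_eq0.
have t2 : (x / y) ^+ 2 * g = x^-1.
  by rewrite expr_div_n y2; field; rewrite ?x0 ?g0.
have tM : M 1 (x / y).
  apply: contraT => /O_inv tO; case/negP: val_ge1_N1.
  have -> : 1 = (x / y) ^+ 2 * (x / y)^-1 ^+ 2 by field; rewrite ?x0 ?y0.
  by rewrite val_geMr ?rpredX //; apply: (val_ge_unit gu gO); rewrite t2.
split=> //; exists g => //.
by rewrite exprS -mulrA t2; field; rewrite ?x0 ?y0.
Qed.

(** In the coordinates t = x / y, s = 1 / y the equation is s g = t^3 with g congruent to 1. Since g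
    = x t^2, an integral x would give g positive order. *)
Lemma ker_of_param x y : on_curve E (Some (x, y)) -> y != 0 ->
  M 1 (x / y) -> M 1 y^-1 -> x \notin O.
Proof.
move=> /on_curve13 c y0; set t := x / y; set s := y^-1 => ht hs.
have [tO sO] := (val_ge_int ht, val_ge_int hs).
have y1 : y = s^-1 by rewrite invrK.
have s0 : s != 0 by rewrite invr_eq0.
have x1 : x = t / s by rewrite /t /s invrK divfK.
set g := 1 + (- (a2 * t ^+ 2) - a4 * t * s - a6 * s ^+ 2).
have gM : M 1 (- (a2 * t ^+ 2) - a4 * t * s - a6 * s ^+ 2).
  rewrite val_geB // ?val_geB ?val_geN //; first by rewrite val_geMl // expr2
    val_geMl.
    by rewrite -mulrA val_geMl // val_geMl.
  by rewrite val_geMl // expr2 val_geMl.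
have cs : s * g = t ^+ 3.
  suff : y ^+ 2 * s ^+ 3 = (x ^+ 3 + a2 * x ^+ 2 + a4 * x + a6) * s ^+ 3.
    by rewrite y1 x1 => h; rewrite /g; apply/eqP; rewrite -subr_eq0; apply/eqP;
      move/eqP: h; rewrite -subr_eq0 => /eqP <-; field.
  by rewrite c.
have gu : ~~ M 1 g := val_ge1_1D gM.
have t0 : t != 0.
  apply: contra gu => /eqP tz; move/eqP: cs.
  by rewrite tz expr0n /= mulf_eq0 (negPf s0) => /eqP ->; apply: val_ge_zero.
apply/negP => xO; case/negP: gu.
have -> : g = x * t ^+ 2 by rewrite x1; apply: (mulfI s0); rewrite cs; field.
by rewrite val_geMl // expr2 val_geMl.
Qed.

(* On the kernel of reduction the parameter is additive to third order: the
   chord [s = m t + b] in the coordinates [t = x / y], [s = 1 / y] has [m] of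
   order [2 k] and [b] of order [3 k]. *)
Lemma ker_add k P Q : (0 < k)%N -> on_curve E P -> on_curve E Q ->
    in_ker P -> in_ker Q -> M k (tpar P) -> M k (tpar Q) ->
  in_ker (add_coord E P Q) /\
  M (3 * k) (tpar (add_coord E P Q) - (tpar P + tpar Q)).
Proof.
move=> k0; case: P => [[x1 y1]|] cP; last first.
  by move=> _ _ kQ _ _; rewrite /= add0r subrr val_ge_zero.
case: Q => [[x2 y2]|] cQ; last by move=> kP _ _ _;
  rewrite /= addr0 subrr val_ge_zero.
move=> kP kQ tP tQ.
have [o|o] := boolP ((x1 == x2) && (y1 + y2 + wa1 E * x2 + wa3 E == 0)).
  rewrite /add_coord o; split=> //=; case/andP: o => /eqP ->.
  rewrite a1_0 a3_0 mul0r !addr0 addr_eq0 => /eqP ->.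
  by rewrite invrN mulrN addNr subrr val_ge_zero.
have [l [n [x3 [e1 e2 [c1 c2 c3]]]]] := add_coord_cut cP cQ o.
have := add_coord_on_curve cP cQ; move=> /[swap] e3; rewrite e3 => cR.
have [x10 y10 _ [w1 w1O s1E]] := ker_param cP kP.
have [x20 y20 _ [w2 w2O s2E]] := ker_param cQ kQ.
rewrite a1_0 a3_0 !mul0r ?addr0 ?subr0 in c1 c2 c3.
have {}cP := on_curve13 cP; have {}cQ := on_curve13 cQ.
rewrite /= in tP tQ.
set t1 := x1 / y1 in tP s1E; set t2 := x2 / y2 in tQ s2E.
set s1 := y1^-1 in s1E; set s2 := y2^-1 in s2E.
have s1M : M (3 * k) s1 by rewrite s1E val_geMr // mulnC val_geX.
have s2M : M (3 * k) s2 by rewrite s2E val_geMr // mulnC val_geX.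
have s10 : s1 != 0 by rewrite invr_eq0.
have s20 : s2 != 0 by rewrite invr_eq0.
have y1E : y1 = s1^-1 by rewrite invrK.
have y2E : y2 = s2^-1 by rewrite invrK.
have x1E : x1 = t1 / s1 by rewrite invrK divfK.
have x2E : x2 = t2 / s2 by rewrite invrK divfK.
have L1 : l * t1 + n * s1 = 1 by rewrite /t1 /s1 mulrA -mulrDl -e1 divff.
have L2 : l * t2 + n * s2 = 1 by rewrite /t2 /s2 mulrA -mulrDl -e2 divff.
have cs1 : s1 = t1 ^+ 3 + a2 * t1 ^+ 2 * s1 + a4 * t1 * s1 ^+ 2 + a6 * s1 ^+ 3.
  transitivity (y1 ^+ 2 * s1 ^+ 3); first by rewrite y1E; field.
  by rewrite cP x1E; field.
have cs2 : s2 = t2 ^+ 3 + a2 * t2 ^+ 2 * s2 + a4 * t2 * s2 ^+ 2 + a6 * s2 ^+ 3.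
  transitivity (y2 ^+ 2 * s2 ^+ 3); first by rewrite y2E; field.
  by rewrite cQ x2E; field.
(* The difference of the equations [cs1] and [cs2] factors as [(s2 - s1) * D = (t2 - t1) * N]. As
   [D] is a unit, [N / D] is integral, and it is the slope of the chord even when the two points
   coincide. *)
set D := 1 + (- (a2 * t2 ^+ 2) - a4 * (t2 * (s1 + s2))
  - a6 * (s1 ^+ 2 + s1 * s2 + s2 ^+ 2)).
set N := t1 ^+ 2 + t1 * t2 + t2 ^+ 2 + a2 * ((t1 + t2) * s1) + a4 * s1 ^+ 2.
have DN : (s2 - s1) * D = (t2 - t1) * N.
  move/eqP: cs1; move/eqP: cs2; rewrite -subr_eq0 => /eqP h2;
    rewrite -subr_eq0 => /eqP h1.
  by apply/eqP; rewrite -subr_eq0 -(subrr 0) -{1}h2 -h1 /D /N; apply/eqP; ring.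
have le1 : (1 <= k)%N by [].
have le2 : (1 <= 3 * k)%N by rewrite muln_gt0.
have [[[t1O t2O] s1O] s2O] := (val_ge_int tP, val_ge_int tQ, val_ge_int s1M,
  val_ge_int s2M).
have [[[t1M1 t2M1] s1M1] s2M1] := (val_ge_le le1 tP, val_ge_le le1 tQ,
  val_ge_le le2 s1M, val_ge_le le2 s2M).
have [Du DO] : ~~ M 1 D /\ D \in O.
  have DM : M 1 (- (a2 * t2 ^+ 2) - a4 * (t2 * (s1 + s2))
      - a6 * (s1 ^+ 2 + s1 * s2 + s2 ^+ 2)).
    apply: val_geB; first apply: val_geB; rewrite ?val_geN;
      apply: val_geMl => //.
    - by rewrite expr2 val_geMl.
    - by rewrite val_geMl // val_geD.
    - by rewrite !val_geD // ?expr2 val_geMl.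
  by split; [apply: val_ge1_1D DM | rewrite rpredD ?rpred1 // (val_ge_int DM)].
have D0 : D != 0 by apply: contra Du => /eqP->; apply: val_ge_zero.
have NM : M (2 * k) N.
  have k2 : (2 * k = k + k)%N by rewrite mul2n addnn.
  have k23 : (2 * k <= 3 * k)%N by rewrite leq_mul2r orbT.
  have s1M2 := val_ge_le k23 s1M.
  rewrite k2 in s1M2 *; apply: val_geD; last by rewrite val_geMl // expr2
    val_geMl.
  apply: val_geD; last by rewrite val_geMl // val_geMl // rpredD.
  by rewrite !val_geD // ?expr2 val_geM.
have t_inj : t1 = t2 -> x1 = x2 /\ y1 = y2.
  move=> e; have /eqP : (s2 - s1) * D = 0 by rewrite DN e subrr mul0r.
  by rewrite mulf_eq0 (negPf D0) orbF subr_eq0 x1E x2E y1E y2E e => /eqP ->.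
(* The line y = l x + n reads 1 = l t + n s, of slope - l / n. For distinct points the claim follows
   from [DN]; in the tangent case [DN] is void and the doubling formulas are used. *)
have [n0 mE] : n != 0 /\ - l * D = n * N.
  have [ex|nx] := eqVneq x1 x2; last first.
    have nt : t2 - t1 != 0.
      by rewrite subr_eq0; apply: contra nx => /eqP/esym/t_inj[-> _].
    have n0 : n != 0.
      apply/eqP => nz; rewrite nz !mul0r !addr0 in L1 L2.
      case/eqP: nt; apply/eqP; rewrite subr_eq0; apply/eqP.
      by apply: (@mulfI _ l); [apply: contraTneq isT => lz; move/eqP: L1;
        rewrite lz mul0r eq_sym oner_eq0 | rewrite L1 L2].
    split=> //; apply: (mulfI nt).
    transitivity (n * ((s2 - s1) * D) + D * (l * t1 + n * s1 - (l * t2 + n *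
      s2))).
      by ring.
    by rewrite DN L1 L2 subrr mulr0 addr0; ring.
  have {ex} [et es] : t2 = t1 /\ s2 = s1.
    have : (y1 - y2) * (y1 + y2) = 0 by rewrite -subr_sqr cP cQ ex subrr.
    move: o; rewrite ex eqxx a1_0 a3_0 mul0r !addr0 /= => o /eqP.
    rewrite mulf_eq0 (negPf o) orbF subr_eq0 => /eqP ey.
    by rewrite /t2 /t1 /s2 /s1 ex ey.
  have ex : x2 = x1 by rewrite x2E x1E et es.
  have ey : y2 = y1 by rewrite y2E y1E es.
  have Y0 : 2 * y1 != 0.
    move: o; rewrite ex ey eqxx a1_0 a3_0 mul0r !addr0 /=.
    by congr (_ != 0); ring.
  have s1y : s1 * y1 = 1 by rewrite mulVf.
  have t1y : x1 = t1 * y1 by rewrite divfK.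
  have Nf : N * y1 ^+ 2 = 3 * x1 ^+ 2 + 2 * a2 * x1 + a4.
    transitivity (3 * (t1 * y1) ^+ 2 + 2 * a2 * (t1 * y1) * (s1 * y1) + a4 * (s1
      * y1) ^+ 2).
      by rewrite /N et; ring.
    by rewrite s1y -t1y expr1n !mulr1.
  have Df : D * y1 ^+ 2 = - (2 * y1 ^+ 2 - x1 * (3 * x1 ^+ 2 + 2 * a2 * x1 +
    a4)).
    transitivity (y1 ^+ 2 - a2 * (t1 * y1) ^+ 2 - 2 * a4 * (t1 * y1) * (s1 * y1)
      - 3 * a6 * (s1 * y1) ^+ 2).
      by rewrite /D et es; ring.
    by rewrite s1y -t1y expr1n !mulr1 cP; ring.
  have lY : 2 * y1 * l = N * y1 ^+ 2.
    rewrite Nf; transitivity (2 * x1 * (l ^+ 2 - a2) + (2 * l * (y1 - l * x1)) +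
      2 * a2 * x1).
      by ring.
    rewrite ex in c1 c2; rewrite -c1 (_ : y1 - l * x1 = n); last by rewrite e1;
      ring.
    have -> : 2 * l * n = a4 - (x1 * x1 + x1 * x3 + x1 * x3) by rewrite c2;
      ring.
    by ring.
  have nY : 2 * y1 * n = - (D * y1 ^+ 2).
    by rewrite Df opprK -Nf -lY [in LHS](_ : n = y1 - l * x1);
      [ring | rewrite e1; ring].
  split.
    have : 2 * y1 * n != 0 by rewrite nY oppr_eq0 mulf_neq0 // expf_neq0.
    by apply: contra => /eqP ->; rewrite mulr0.
  apply: (mulfI Y0); transitivity (- (2 * y1 * l) * D); first by ring.
  by rewrite lY; transitivity ((2 * y1 * n) * N); [rewrite nY; ring | ring].
set m := - l / n; set b := n^-1.
have mM : M (2 * k) m.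
  apply: (val_ge_unit Du DO); suff -> : m * D = N by [].
  by apply: (mulfI n0); rewrite -mE /m; field.
have k23 : (2 * k <= 3 * k)%N by rewrite leq_mul2r orbT.
have mO := val_ge_int mM.
have mM1 : M 1 m by apply: val_ge_le mM; rewrite muln_gt0.
have bE : b = s1 - m * t1.
  apply: (mulfI n0); rewrite /b /m divff //.
  by transitivity (l * t1 + n * s1); [rewrite L1 | field].
have bM : M (3 * k) b.
  rewrite bE val_geB //; suff -> : (3 * k = 2 * k + k)%N by rewrite val_geM.
  by rewrite -mulSnr.
have bO := val_ge_int bM.
(* Substituting s = m t + b into the equation in t and s gives a cubic in t with leading coefficient
   [C]; [tsum] below is Vieta's formula for the sum of its roots. *)
set C := 1 + (a2 * m + a4 * m ^+ 2 + a6 * m ^+ 3).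
have [Cu CO] : ~~ M 1 C /\ C \in O.
  have hX j : M 1 (m ^+ j.+1) by rewrite exprS val_geMr // rpredX.
  have CM : M 1 (a2 * m + a4 * m ^+ 2 + a6 * m ^+ 3).
    by apply: val_geD (val_geMl a6O (hX 2)); apply: val_geD (val_geMl a2O mM1)
      (val_geMl a4O (hX 1)).
  by split; [apply: val_ge1_1D CM | rewrite rpredD ?rpred1 // (val_ge_int CM)].
have C0 : C != 0 by apply: contra Cu => /eqP->; apply: val_ge_zero.
set y3 := l * x3 + n in e3 cR *.
have lE : l = - m * n by rewrite /m; field.
have a2E : a2 = l ^+ 2 - (x1 + x2 + x3) by rewrite c1; ring.
have a4E : a4 = 2 * l * n + (x1 * x2 + x1 * x3 + x2 * x3) by rewrite c2; ring.
have a6E : a6 = n ^+ 2 - x1 * x2 * x3 by rewrite c3; ring.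
have yyy : y1 * y2 * y3 = n ^+ 3 * C.
  by rewrite /C a2E a4E a6E e1 e2 /y3 lE; ring.
have y30 : y3 != 0.
  have : y1 * y2 * y3 != 0 by rewrite yyy mulf_neq0 // expf_neq0.
  by apply: contra => /eqP ->; rewrite mulr0.
have tsum : (t1 + t2 + x3 / y3) * C = - (a2 + 2 * a4 * m + 3 * a6 * m ^+ 2) * b.
  have n30 : n ^+ 3 != 0 by rewrite expf_neq0.
  apply: (mulIf n30); transitivity ((t1 + t2 + x3 / y3) * (n ^+ 3 * C));
    first by ring.
  rewrite -yyy.
  transitivity (x1 * y2 * y3 + x2 * y1 * y3 + x3 * y1 * y2).
    by rewrite /t1 /t2; field; rewrite y30 y10 y20.
  rewrite /b a2E a4E a6E.
  transitivity (- (n ^+ 2 * (l ^+ 2 - (x1 + x2 + x3) + 2 * (2 * l * n + (x1 * x2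
    + x1 * x3 + x2 * x3)) * m +
     3 * (n ^+ 2 - x1 * x2 * x3) * m ^+ 2))); last by field.
  by rewrite /y3 e1 e2 lE; ring.
have t3M : M (3 * k) (t1 + t2 + x3 / y3).
  apply: (val_ge_unit Cu CO); rewrite tsum val_geMl // rpredN.
  have natM j u : u \in O -> j%:R * u \in O by move=> uO;
    rewrite rpredM // rpred_nat.
  by rewrite rpredD ?rpredD // rpredM ?natM // rpredX.
have k13 : (k <= 3 * k)%N by rewrite leq_pmull.
have t3k : M k (x3 / y3).
  rewrite (_ : x3 / y3 = (t1 + t2 + x3 / y3) - (t1 + t2)); last by ring.
  exact: val_geB (val_ge_le k13 t3M) (val_geD tP tQ).
have s3E : y3^-1 = b + m * (x3 / y3).
  by rewrite /b /m; apply: (mulfI y30); rewrite divff //; rewrite /y3; field;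
    rewrite -/y3 ?y30.
have s3M : M (3 * k) y3^-1.
  rewrite s3E val_geD //; suff -> : (3 * k = 2 * k + k)%N by rewrite val_geM.
  by rewrite -mulSnr.
have o3 : oppy E x3 y3 = - y3 by rewrite /oppy a1_0 a3_0 mul0r !subr0.
rewrite /in_ker /tpar o3; split; last first.
  by rewrite invrN mulrN -opprD val_geN addrC.
rewrite o3 in cR; apply: (ker_of_param cR); rewrite ?oppr_eq0 // invrN ?mulrN
  val_geN.
  exact: val_ge_le t3k.
exact: val_ge_le s3M.
Qed.

Lemma ker_mul k (P : point E) n : (0 < k)%N -> in_ker (val P) ->
    M k (tpar (val P)) ->
  in_ker (val (P *+ n)) /\ M (3 * k) (tpar (val (P *+ n)) - tpar (val P) *+ n).
Proof.
move=> k0 kP tP; elim: n => [|n [IH1 IH2]]; first by rewrite !mulr0n subrr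
  val_ge_zero.
have k13 : (k <= 3 * k)%N by rewrite leq_pmull.
have tn : M k (tpar (val (P *+ n))).
  rewrite -(subrK (tpar (val P) *+ n) (tpar _)) val_geD //;
    first exact: val_ge_le IH2.
  by rewrite -mulr_natl val_geMl // rpred_nat.
have [h1 h2] := ker_add k0 (valP P) (valP (P *+ n)) kP IH1 tP tn.
rewrite mulrS; split=> //.
rewrite -[val (P + _)]/(add_coord E (val P) (val (P *+ n))) mulrS.
set u := tpar (add_coord _ _ _) in h2 *.
rewrite (_ : u - _ = (u - (tpar (val P) + tpar (val (P *+ n))))
   + (tpar (val (P *+ n)) - tpar (val P) *+ n)); last by ring.
exact: val_geD.
Qed.

(** If t has exact order k, then q t has order k for q distinct from p and k + 1 for q = p. Both are
    less than 3 k, the order that q P = 0 would impose. *)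
Lemma ker_prime_torsion (P : point E) q : prime q -> in_ker (val P) ->
  P *+ q = 0 -> P = 0.
Proof.
move=> q_pr; case eP: (val P) => [[x y]|] //= kP qP0; last by apply: val_inj.
have cP := valP P; rewrite eP in cP.
have [x0 y0 tM _] := ker_param cP kP.
have t0 : x / y != 0 by rewrite mulf_neq0 // invr_eq0.
have [k [k0 tk ntk]] := val_exact t0 tM.
have [] := @ker_mul k P q k0; rewrite ?eP // qP0 /= sub0r val_geN => _.
rewrite -mulr_natl => h; case/negP: ntk.
have kk := leq_add2_mul3 k0.
have [eq|nq] := eqVneq q p.
  have {}h := val_ge_le kk h; move: h; rewrite eq /M.
  suff -> : p%:R * (x / y) / p%:R ^+ k.+2 = x / y / p%:R ^+ k.+1 by [].
  by rewrite (exprS _ k.+1); field; rewrite y0 p_neq0 pX_neq0.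
have qu : ~~ M 1 q%:R.
  have cop : coprime p q by rewrite prime_coprime // dvdn_prime2 // eq_sym.
  have [u v uv _] := egcdnP q (prime_gt0 p_prime).
  apply/negP => hq; case/negP: val_ge1_N1.
  have -> : 1 = (u * p)%:R - (v * q)%:R :> K.
    by rewrite uv (eqP cop) natrD addrAC subrr add0r.
  rewrite !natrM val_geB // val_geMl // ?rpred_nat //.
  by rewrite /M expr1 divff // rpred1.
apply: (val_ge_unit qu); first exact: rpred_nat.
by rewrite mulrC; apply: val_ge_le h; apply: ltnW.
Qed.

Lemma ker_torsion_free n (P : point E) : (0 < n)%N -> in_ker (val P) ->
  P *+ n = 0 -> P = 0.
Proof.
elim/ltn_ind: n P => n IH P n0 kP nP0.
have [n1|n1] := leqP n 1; first by rewrite -nP0 (eqP (_ : n == 1%N)) // eqn_leq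
  n1.
have q_pr := pdiv_prime n1; have q_dv := pdiv_dvd n.
have kQ : in_ker (val (P *+ (n %/ pdiv n))).
  case eP: (val P) => [[x y]|] //.
    have cP := valP P; rewrite eP in cP kP.
    have [_ _ tM _] := ker_param cP kP.
    by case: (@ker_mul 1 P (n %/ pdiv n)); rewrite ?eP.
  by rewrite (_ : P = 0) ?mul0rn //; apply: val_inj.
have Q0 : P *+ (n %/ pdiv n) = 0.
  by apply: (ker_prime_torsion q_pr kQ); rewrite -mulrnA divnK.
apply: IH Q0 => //; first by rewrite ltn_Pdiv ?prime_gt1.
by rewrite divn_gt0 ?prime_gt0 // dvdn_leq.
Qed.

Hypothesis unit2 : ~~ M 1 2.
(** Smoothness of the reduced curve, at the points where the derivative 2 y in the ordinate vanishes
    modulo p. *)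
Hypothesis good_reduction : forall x y, on_curve E (Some (x, y)) -> x \in O ->
  M 1 y -> ~~ M 1 (3 * x ^+ 2 + 2 * a2 * x + a4).

Lemma O_sqr x : x ^+ 2 \in O -> x \in O.
Proof.
move=> h; apply: contraT => nx; case/negP: val_ge1_N1.
have x0 : x != 0 by apply: contra nx => /eqP ->; apply: rpred0.
have -> : 1 = x ^+ 2 * (x^-1 * x^-1) by field.
have hx := val_ge1_inv nx; by rewrite val_geMl // val_geMl // (val_ge_int hx).
Qed.

Lemma on_curve_integral x y : on_curve E (Some (x, y)) -> x \in O -> y \in O.
Proof.
by move=> /on_curve13 c xO; apply: O_sqr; rewrite c !rpredD ?rpredM ?rpredX.
Qed.

(** If the abscissa x3 of P - Q were integral, so would be the slope l, by l^2 = x1 + x2 + x3 + a2.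
    Then y1 + y2 = l (x1 - x2) vanishes modulo p, hence so does y1, and the derivative 2 l y1 + (x1
    - x3) (x1 - x2) of the cubic at x1 does too, against good reduction. *)
Lemma ker_sub (P Q : point E) x1 y1 x2 y2 :
    val P = Some (x1, y1) -> val Q = Some (x2, y2) -> x1 \in O -> x2 \in O ->
  M 1 (x1 - x2) -> M 1 (y1 - y2) -> in_ker (val (P - Q)).
Proof.
move=> eP eQ x1O x2O xM yM; have cP := valP P; have cQ := valP (- Q).
have oQ : val (- Q) = Some (x2, - y2).
  rewrite -[val (- Q)]/(opp_coord E (val Q)) eQ /=.
  by rewrite /oppy a1_0 a3_0 mul0r !subr0.
rewrite eP oQ in cP cQ; rewrite -[val (P - Q)]/(add_coord E (val P) (val (- Q)))
  eP oQ.
have [|o] := boolP ((x1 == x2) && (y1 - y2 + wa1 E * x2 + wa3 E == 0)).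
  by rewrite /add_coord => ->.
have [l [n [x3 [e1 e2 [c1 c2 _] ->]]]] := add_coord_cut cP cQ o.
rewrite a1_0 a3_0 !mul0r ?addr0 ?subr0 in c1 c2.
rewrite /in_ker; apply/negP => x3O.
have lO : l \in O.
  by apply: O_sqr; rewrite (_ : l ^+ 2 = x1 + x2 + x3 + a2) ?rpredD // c1 subrK.
have y1O := on_curve_integral cP x1O.
have y1M : M 1 y1.
  apply: (val_ge_unit unit2); first exact: rpred_nat.
  rewrite (_ : y1 * 2 = (y1 - y2) + (y1 - - y2)); last by ring.
  apply: val_geD => //; rewrite (_ : _ - _ = l * (x1 - x2)) ?val_geMl //.
  by rewrite e2 e1; ring.
have /negP[] := good_reduction cP x1O y1M.
rewrite (_ : _ + a4 = l * (2 * y1) + (x1 - x3) * (x1 - x2)).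
  by rewrite val_geD ?val_geMl ?rpredB // rpred_nat.
rewrite (_ : a2 = l ^+ 2 - (x1 + x2 + x3)); last by rewrite c1; ring.
rewrite (_ : a4 = x1 * x2 + x1 * x3 + x2 * x3 + 2 * l * n); last by rewrite c2;
  ring.
by rewrite e1; ring.
Qed.

Lemma torsion_sub (P Q : point E) : is_torsion P -> is_torsion Q -> is_torsion
  (P - Q).
Proof.
move=> /is_torsionE[n n0 nP] /is_torsionE[m m0 mQ]; apply/is_torsionE.
exists (n * m)%N; first by rewrite muln_gt0 n0.
by rewrite mulrnBl mulrnA nP mul0rn mulnC mulrnA mQ mul0rn subrr.
Qed.

Lemma torsion_integral (P : point E) x y : is_torsion P ->
  val P = Some (x, y) -> x \in O /\ y \in O.
Proof.
move=> /is_torsionE[n n0 nP] eP; suff xO : x \in O.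
  by split=> //; apply: on_curve_integral xO; rewrite -eP; apply: valP.
apply: contraT => kP; have := ker_torsion_free n0 _ nP.
by rewrite eP /= => /(_ kP) P0; move: eP; rewrite P0.
Qed.

Lemma torsion_red_inj (P Q : point E) x1 y1 x2 y2 :
    is_torsion P -> is_torsion Q ->
    val P = Some (x1, y1) -> val Q = Some (x2, y2) ->
  M 1 (x1 - x2) -> M 1 (y1 - y2) -> P = Q.
Proof.
move=> tP tQ eP eQ xM yM.
have [x1O _] := torsion_integral tP eP; have [x2O _] := torsion_integral tQ eQ.
have /is_torsionE[n n0 h] := torsion_sub tP tQ.
apply/eqP; rewrite -subr_eq0; apply/eqP.
exact: ker_torsion_free n0 (ker_sub eP eQ x1O x2O xM yM) h.
Qed.

End KernelOfReduction.

(** * Traces in cubic fields *)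

Section NumberFieldTrace.
Variable L : fieldExtType rat.
Local Notation ratL := (map_poly (in_alg L)).
Local Notation pZtoQ := (map_poly (intr : int -> rat)).

Lemma trace_linear : linear_for *%R (@field_trace L).
Proof.
move=> a x y; rewrite /field_trace amull_is_linear passmx.mxof_linear.
by rewrite mxtraceD mxtraceZ.
Qed.

HB.instance Definition _ :=
  GRing.isSemilinear.Build rat L rat _ (@field_trace L)
    (GRing.semilinear_linear trace_linear).

Lemma rat_minpoly (x : L) : exists q : {poly rat},
  [/\ q \is monic, size q = (adjoin_degree 1 x).+1, root (ratL q) x
    & forall r : {poly rat}, root (ratL r) x -> q %| r].
Proof.
have /polyOver1P[q qE] := minPolyOver 1 x.
have szq : size q = (adjoin_degree 1 x).+1 by rewrite -size_minPoly qE
  size_map_poly.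
exists q; split=> //.
- by rewrite -(map_monic (in_alg L)) -qE monic_minPoly.
- by rewrite -qE root_minPoly.
move=> r rx; rewrite -(dvdp_map (in_alg L)) -qE minPoly_dvdp //.
by apply/polyOver1P; exists r.
Qed.

Lemma integral_ratP (x : L) :
  integralOver (intr : int -> L) x <->
    exists2 p : {poly int}, p \is monic & root (ratL (pZtoQ p)) x.
Proof.
have mapE (p : {poly int}) : ratL (pZtoQ p) = map_poly (intr : int -> L) p.
  by rewrite -map_poly_comp; apply: eq_map_poly => z /=; rewrite scaler_int.
by split=> -[p mp rp]; exists p => //; rewrite mapE in rp *.
Qed.

(** Gauss's lemma: the minimal polynomial is a rational multiple of an integral factor of a monic
    polynomial, and the leading coefficient of that factor is a unit. *)
Lemma integral_minpoly (x : L) (q : {poly rat}) :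
    integralOver (intr : int -> L) x -> q \is monic ->
    (forall r : {poly rat}, root (ratL r) x -> q %| r) ->
  exists p : {poly int}, q = pZtoQ p.
Proof.
move=> /integral_ratP[p mp rp] mq /(_ _ rp) /dvdpP_rat_int[p1 [a a0 qE] [r pE]].
have : lead_coef p1 * lead_coef r = 1 by rewrite -lead_coefM -pE (monicP mp).
have la : a * (lead_coef p1)%:~R = 1.
  have := monicP mq; rewrite qE lead_coefZ lead_coef_map_inj //.
  exact: (@intr_inj rat).
rewrite mulrC => /intUnitRing.unitzPl; rewrite qualifE /= => /orP[] /eqP u1.
  exists p1; rewrite qE; suff -> : a = 1 by rewrite scale1r.
  by rewrite -la u1 mulr1.
exists (- p1); rewrite qE rmorphN /=; suff -> : a = -1 by rewrite scaleN1r.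
by apply: oppr_inj; rewrite opprK -[RHS]la u1 mulrN1.
Qed.

(** The row of basis elements is an eigenvector, over [L], of the transposed matrix of
    multiplication by [x]. So the characteristic polynomial vanishes at [x], and it has the degree
    of [q]. *)
Lemma trace_charpoly (x : L) (q : {poly rat}) :
    q \is monic -> size q = (\dim {:L}).+1 -> root (ratL q) x ->
    (forall r : {poly rat}, root (ratL r) x -> q %| r) ->
  field_trace x = - q`_(\dim {:L}).-1.
Proof.
move=> mq sq rq qmin; set n := \dim {:L} in sq *.
have n0 : (0 < n)%N by rewrite /n adim_gt0.
set e := vbasis {:L}; have be : basis_of {:L} e := vbasisP _.
set A := passmx.mxof e e (amull x).
suff <- : char_poly A^T = q by rewrite char_poly_trace // opprK mxtrace_tr.
apply/eqP; rewrite -eqp_monic ?char_poly_monic // eqp_sym -dvdp_size_eqp.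
  by rewrite sq size_char_poly.
apply: qmin; rewrite map_char_poly -eigenvalue_root_char.
apply/eigenvalueP; exists (\row_i e`_i).
  apply/rowP => j; rewrite !mxE.
  have -> : x * e`_j = \sum_(k < n) coord e k (x * e`_j) *: e`_k.
    by rewrite -(coord_basis be) ?memvf.
  apply: eq_bigr => k _; rewrite !mxE /= passmx.vecof_delta lfunE /=.
  by rewrite mulr_algr.
have : e`_0 != 0.
  by apply: free_not0 (basis_free be) _; rewrite mem_nth // size_tuple.
by apply: contra => /eqP/rowP/(_ (Ordinal n0)) /eqP; rewrite !mxE.
Qed.

Lemma trace_alg (a : rat) : field_trace (a%:A : L) = a *+ \dim {:L}.
Proof.
rewrite linearZ /=; have -> : field_trace (1 : L) = (\dim {:L})%:R.
  by rewrite /field_trace amull1 passmx.mxof1 ?mxtrace1 // (basis_free (vbasisP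
    _)).
by rewrite mulr_natr.
Qed.

Lemma integral_rat (a : rat) :
  integralOver (intr : int -> L) a%:A -> exists z : int, a = z%:~R.
Proof.
move=> aint; have [r|p pE] := @integral_minpoly a%:A ('X - a%:P) aint
  (monicXsubC _).
  by rewrite (fmorph_root (in_alg L)) dvdp_XsubCl.
exists (- p`_0); apply: oppr_inj; rewrite rmorphN opprK /=.
by rewrite -(coef_map (intr : int -> rat)) -pE coefB coefX coefC sub0r.
Qed.

End NumberFieldTrace.

Section CubicField.
Variable L : fieldExtType rat.
Hypothesis dimL : \dim {:L} = 3%N.
Local Notation ratL := (map_poly (in_alg L)).
Local Notation pZtoQ := (map_poly (intr : int -> rat)).
Implicit Types x u v w : L.

Definition indep3 u v w := forall a b c : rat,
  a *: u + b *: v + c *: w = 0 -> [/\ a = 0, b = 0 & c = 0].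

Lemma indep3_basis u v w : indep3 u v w <-> basis_of {:L} [:: u; v; w].
Proof.
rewrite basisEfree subvf dimL leqnn !andbT.
have freeE := @freeP _ _ 3 [tuple u; v; w].
have sumE (k : 'I_3 -> rat) : \sum_(i < 3) k i *: [tuple u; v; w]`_i
    = k 0 *: u + k 1 *: v + k 2%:R *: w.
  by rewrite !big_ord_recr big_ord0 /= add0r; do 2?congr (_ + _);
    congr (k _ *: _); apply: val_inj.
split=> [ind|/freeE fr a b c e].
  apply/freeE => k; rewrite sumE => /ind[k0 k1 k2] i.
  case: i => -[|[|[|//]]] lt; [rewrite -[RHS]k0|rewrite -[RHS]k1|rewrite
    -[RHS]k2];
    by congr (k _); apply: val_inj.
have := fr (fun i => [tuple a; b; c]`_i); rewrite sumE /= => /(_ e) z.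
by split; [have := z 0 | have := z 1 | have := z 2%:R].
Qed.

Lemma indep3_span u v w x : indep3 u v w ->
  exists a b c : rat, x = a *: u + b *: v + c *: w.
Proof.
move=> /indep3_basis/span_basis bs; have : x \in <<[:: u; v;
  w]>>%VS by rewrite bs memvf.
rewrite !span_cons span_nil addv0 => /memv_addP[_ /vlineP[a ->] [y + ->]].
move=> /memv_addP[_ /vlineP[b ->] [_ /vlineP[c ->] ->]].
by exists a, b, c; rewrite addrA.
Qed.

Lemma cubic_degree x : x \notin 1%VS -> adjoin_degree 1 x = 3%N.
Proof.
move=> nx; have := dim_sup_field (subvf <<1; x>>%AS); rewrite dimL.
rewrite dim_Fadjoin dimv1 muln1 => /esym e.
have : adjoin_degree 1 x != 1%N by rewrite adjoin_deg_eq1.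
have : (adjoin_degree 1 x %| 3)%N by rewrite -e dvdn_mull.
by rewrite dvdn_divisors // !inE => /orP[/eqP->|/eqP->].
Qed.

Lemma horner3 (q : {poly rat}) x : (size q <= 3)%N ->
  (ratL q).[x] = q`_0 *: 1 + q`_1 *: x + q`_2 *: x ^+ 2.
Proof.
move=> sq; rewrite (@horner_coef_wide _ 3) ?size_map_poly //.
by rewrite !big_ord_recr big_ord0 /= !coef_map /= add0r expr0 mulr1 !mulr_algl.
Qed.

Lemma indep3_powers x : x \notin 1%VS -> indep3 1 x (x ^+ 2).
Proof.
move=> nx a b c e; have [q [_ sq _ qmin]] := rat_minpoly x.
rewrite (cubic_degree nx) in sq.
pose r := Poly [:: a; b; c]; have sr : (size r <= 3)%N by apply: size_Poly.
have rE : (ratL r).[x] = 0 by rewrite horner3 // !coef_Poly.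
have r0 : r = 0.
  apply: contraTeq sr => r0; rewrite -ltnNge -sq; apply: dvdp_leq => //.
  by apply: qmin; apply/rootP.
by have co i : r`_i = 0 by [rewrite r0 coef0]; split;
  [have := co 0%N | have := co 1%N | have := co 2]; rewrite coef_Poly.
Qed.

Lemma cubic_minpoly x : x \notin 1%VS ->
  exists q : {poly rat}, [/\ q \is monic, size q = 4%N, root (ratL q) x
    & forall r : {poly rat}, root (ratL r) x -> q %| r].
Proof. by move=> nx; have := rat_minpoly x; rewrite cubic_degree. Qed.

Lemma horner4 (q : {poly rat}) x : q \is monic -> size q = 4%N ->
  (ratL q).[x] = q`_0 *: 1 + q`_1 *: x + q`_2 *: x ^+ 2 + x ^+ 3.
Proof.
move=> mq sq; rewrite (@horner_coef_wide _ 4) ?size_map_poly ?sq //.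
rewrite !big_ord_recr big_ord0 /= !coef_map /= add0r expr0 mulr1 !mulr_algl.
by have := monicP mq; rewrite /lead_coef sq /= => ->; rewrite scale1r.
Qed.

Lemma trace_cubic x (e1 e2 e3 : rat) : x \notin 1%VS ->
  x ^+ 3 = e1 *: x ^+ 2 - e2 *: x + e3%:A -> field_trace x = e1.
Proof.
move=> nx ex; have [q [mq sq rq qmin]] := cubic_minpoly nx.
rewrite (trace_charpoly mq _ rq qmin) dimL //=.
have := rootP rq; rewrite horner4 // ex => h.
have [|_ _ /eqP] := indep3_powers nx (a := q`_0 + e3) (b := q`_1 - e2) (c :=
  q`_2 + e1).
  by rewrite -h !scalerDl scaleNr; ring.
by rewrite addr_eq0 => /eqP ->; rewrite opprK.
Qed.

Lemma integral_cubic x : x \notin 1%VS -> integralOver (intr : int -> L) x ->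
  exists e1 e2 e3 : int, x ^+ 3 = e1%:~R *: x ^+ 2 - e2%:~R *: x + e3%:~R%:A.
Proof.
move=> nx ix; have [q [mq sq rq qmin]] := cubic_minpoly nx.
have [p pE] := integral_minpoly ix mq qmin.
have cE i : q`_i = (p`_i)%:~R by rewrite pE coef_map.
exists (- p`_2), p`_1, (- p`_0).
have := rootP rq; rewrite horner4 // !cE => h.
apply/eqP; rewrite -subr_eq0 -h !rmorphN /= !scaleNr; apply/eqP; ring.
Qed.

Lemma trace_integral x : integralOver (intr : int -> L) x ->
  exists z : int, field_trace x = z%:~R.
Proof.
move=> ix; have [/vlineP[a xE]|nx] := boolP (x \in 1%VS).
  rewrite xE in ix *; have [z ->] := integral_rat ix; exists (z * 3).
  by rewrite trace_alg dimL rmorphM /= mulr_natr.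
have [e1 [e2 [e3 ex]]] := integral_cubic nx ix.
by exists e1; apply: trace_cubic ex.
Qed.

End CubicField.

(** * Binary cubic forms of small discriminant *)

Section BinaryCubicForms.

Definition cubic_disc (R : pzRingType) (a b c d : R) : R :=
  b ^+ 2 * c ^+ 2 - 4 * a * c ^+ 3 - 4 * b ^+ 3 * d - 27 * a ^+ 2 * d ^+ 2
    + 18 * a * b * c * d.

(* Sets of integral binary cubic forms [a x^3 + b x^2 y + c x y^2 + d y^3]
   stable under generators of GL_2(Z). *)
Record cubic_orbit (T : int -> int -> int -> int -> Prop) := CubicOrbit {
  orbit_swap a b c d : T a b c d -> T d c b a;
  orbit_opp a b c d : T a b c d -> T (- a) (- b) (- c) (- d);
  orbit_shift k a b c d : T a b c d ->
    T a (b + 3 * a * k) (c + 2 * b * k + 3 * a * k ^+ 2)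
      (d + c * k + b * k ^+ 2 + a * k ^+ 3);
  orbit_neq0 a b c d : T a b c d -> a != 0
}.

Variable T : int -> int -> int -> int -> Prop.
Hypothesis orbT : cubic_orbit T.

Lemma cubic_disc_swap (R : comPzRingType) (a b c d : R) :
  cubic_disc d c b a = cubic_disc a b c d.
Proof. rewrite /cubic_disc; ring. Qed.

Lemma cubic_disc_shift (R : comPzRingType) (k a b c d : R) :
  cubic_disc a (b + 3 * a * k) (c + 2 * b * k + 3 * a * k ^+ 2)
      (d + c * k + b * k ^+ 2 + a * k ^+ 3) = cubic_disc a b c d.
Proof. rewrite /cubic_disc; ring. Qed.

Lemma int_round (P Q : int) : 0 < P -> exists k, `|Q + 2 * P * k| <= P.
Proof.
move=> P0; exists (- ((Q + P) %/ (2 * P))%Z).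
have := divz_eq (Q + P) (2 * P); have := modz_ge0 (Q + P) (d := 2 * P).
have := ltz_pmod (Q + P) (d := 2 * P).
set q := (_ %/ _)%Z; set r := (_ %% _)%Z; move=> h1 h2 e.
have {}h1 := h1 ltac:(lia). have {}h2 := h2 ltac:(lia).
rewrite ler_norml; apply/andP; split; lia.
Qed.

(* The Hessian of a form of positive discriminant is positive definite; its
   reduction makes the leading coefficient vanish. *)
Lemma cubic_disc_pos a b c d : T a b c d -> 0 < cubic_disc a b c d ->
  23 < cubic_disc a b c d.
Proof.
pose P (a b c d : int) := b ^+ 2 - 3 * a * c.
have P_gt0 a' b' c' d' : T a' b' c' d' -> 0 < cubic_disc a' b' c' d' -> 0 < P a'
  b' c' d'.
  move=> t D0; have a0 := orbit_neq0 orbT t.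
  (* The syzygy between a cubic form, its Hessian and its cubic covariant, read on leading
     coefficients. *)
  have : 4 * P a' b' c' d' ^+ 3 = (2 * b' ^+ 3 - 9 * a' * b' * c' + 27 * a' ^+ 2
    * d') ^+ 2
      + 27 * cubic_disc a' b' c' d' * a' ^+ 2 by rewrite /P /cubic_disc; ring.
  move=> e; have : 0 < P a' b' c' d' ^+ 3.
    rewrite -(pmulr_rgt0 _ (x := 4)) // e ltr_wpDl ?sqr_ge0 //.
    by apply: mulr_gt0; [rewrite mulr_gt0 | rewrite exprn_even_gt0].
  by rewrite exprn_odd_gt0.
move: {-1}(`|P a b c d|%N) (leqnn `|P a b c d|%N) => n.
elim/ltn_ind: n a b c d => n IH a b c d len t D0.
have P0 := P_gt0 _ _ _ _ t D0.
(* [b * c - 9 * a * d] is the middle coefficient of the Hessian. A shift moves it by multiples of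
   [2 P] and the swap exchanges the outer coefficients, so the induction on [P] is Gauss
   reduction. *)
have [k] := int_round (b * c - 9 * a * d) P0.
have {t} := orbit_shift orbT k t; move: D0 len P0.
rewrite -(cubic_disc_shift k a b c d).
have -> : P a b c d = P a (b + 3 * a * k) (c + 2 * b * k + 3 * a * k ^+ 2)
    (d + c * k + b * k ^+ 2 + a * k ^+ 3) by rewrite /P; ring.
have -> : b * c - 9 * a * d + 2 * P a (b + 3 * a * k) (c + 2 * b * k + 3 * a * k
  ^+ 2)
    (d + c * k + b * k ^+ 2 + a * k ^+ 3) * k
  = (b + 3 * a * k) * (c + 2 * b * k + 3 * a * k ^+ 2)
    - 9 * a * (d + c * k + b * k ^+ 2 + a * k ^+ 3) by rewrite /P; ring.
move: (b + _) (c + _ + _) (d + _ + _ + _) => {}b {}c {}d D0 len P0 t Q0.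
have t' := orbit_swap orbT t; rewrite -cubic_disc_swap in D0 *.
have R0 := P_gt0 _ _ _ _ t' D0.
have [lt|ge] := ltP (P d c b a) (P a b c d).
  apply: (IH `|P d c b a|%N) => //; apply: leq_trans len; lia.
rewrite cubic_disc_swap in D0 *.
have a0 := orbit_neq0 orbT t.
have a2 : 1 <= a ^+ 2 by rewrite -gtz0_ge1 exprn_even_gt0.
have e1 : 3 * cubic_disc a b c d = 4 * P a b c d * P d c b a - (b * c - 9 * a *
  d) ^+ 2.
  by rewrite /P /cubic_disc; ring.
have e2 : 4 * P a b c d ^+ 3 = (2 * b ^+ 3 - 9 * a * b * c + 27 * a ^+ 2 * d) ^+
  2
      + 27 * cubic_disc a b c d * a ^+ 2 by rewrite /P /cubic_disc; ring.
move: e1 e2 Q0 ge P0 D0; set D := cubic_disc _ _ _ _.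
move: (P a b c d) (P d c b a) (b * c - _) (_ - _ + 27 * _ * _) => p r q g.
clear -a2; rewrite ler_norml => e1 e2 /andP[q1 q2] ge p0 D0.
(* The inequalities 27 p^2 <= 27 D <= 4 p^3 give p >= 27 / 4, whereas p^2 <= D <= 23 gives p <=
   4. *)
have q3 : q ^+ 2 <= p ^+ 2 by nia.
have Dp : p ^+ 2 <= D by nia.
have : 27 * D <= 4 * p ^+ 3 by nia.
rewrite ltNge; apply: contraTN => D23; rewrite -ltNge.
have p4 : p <= 4 by nia.
nia.
Qed.

(** * Reduction of forms of negative discriminant *)

Section NegativeDiscriminant.
Variable R : archiRcfType.
Implicit Types al be A B C : R.

Lemma cubic_root (b c d : R) : exists x, x ^+ 3 + b * x ^+ 2 + c * x + d = 0.
Proof.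
pose p := 'X^3 + b *: 'X^2 + c *: 'X + d%:P.
have pE x : p.[x] = x ^+ 3 + b * x ^+ 2 + c * x + d by rewrite /p !hornerE.
(* Cauchy's bound: at [M] and [- M] the leading term dominates the others, so the values have
   opposite signs in the weak sense. *)
pose M := 1 + `|b| + `|c| + `|d|.
have [b0 c0 d0] : [/\ 0 <= `|b|, 0 <= `|c| & 0 <= `|d|] by rewrite !normr_ge0.
have M1 : 1 <= M by rewrite /M; lra.
have MM : M <= M ^+ 2 by nra.
have key y : `|y| = M -> `|b * y ^+ 2 + c * y + d| <= M ^+ 3.
  move=> yM; apply: le_trans (ler_normD _ _) _.
  have h := ler_normD (b * y ^+ 2) (c * y).
  rewrite normrM normrX (normrM c) yM in h.
  have h1 : `|c| * M <= `|c| * M ^+ 2 by rewrite ler_wpM2l.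
  have h2 : `|d| <= `|d| * M ^+ 2 by rewrite ler_peMr // (le_trans M1).
  rewrite (_ : M ^+ 3 = (1 + `|b| + `|c| + `|d|) * M ^+ 2);
    last by rewrite -/M exprS.
  rewrite !mulrDl; have := sqr_ge0 M; lra.
have Mge0 : 0 <= M by lra.
have hp := key M (ger0_norm Mge0).
have hn := key (- M) ltac:(by rewrite normrN ger0_norm).
have [||x _ rx] := @poly_ivt R p (- M) M; first lra.
  rewrite !pE; move: hp hn; rewrite !ler_norml => /andP[h1 h2] /andP[h3 h4].
  have -> : (- M) ^+ 3 = - M ^+ 3 by ring.
  by apply/andP; split; lra.
by exists x; rewrite -pE; apply/rootP.
Qed.

(* The factorisation of a form over [R] into a linear and a quadratic factor,
   the latter definite when the discriminant is negative. *)
Definition splits al be A B C (a b c d : int) :=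
  [/\ a%:~R = al * A, b%:~R = al * B + be * A, c%:~R = al * C + be * B
    & d%:~R = be * C].

(** The discriminant of a product of a linear and a quadratic form is that of the quadratic one
    times the square of their resultant. *)
Lemma splits_disc al be A B C a b c d : splits al be A B C a b c d ->
  (cubic_disc a b c d)%:~R
    = (B ^+ 2 - 4 * A * C) * (A * be ^+ 2 - B * be * al + C * al ^+ 2) ^+ 2.
Proof.
move=> [ea eb ec ed].
transitivity (cubic_disc (a%:~R : R) b%:~R c%:~R d%:~R); rewrite /cubic_disc;
  first ring.
by rewrite ea eb ec ed; ring.
Qed.

Lemma real_round (P Q : R) : 0 < P -> exists k : int, `|Q + 2 * P * k%:~R| <= P.
Proof.
move=> P0; exists (- Num.floor ((Q + P) / (2 * P))).
have := floor_itv ((Q + P) / (2 * P)); set k := Num.floor _.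
have P2 : 0 < 2 * P by lra.
rewrite ler_pdivlMr // ltr_pdivrMr // rmorphD rmorphN /= => /andP[h1 h2].
by rewrite ler_norml; apply/andP; split; lra.
Qed.

Lemma splits_shift (k : int) al be A B C a b c d : splits al be A B C a b c d ->
  splits al (be + k%:~R * al) A (B + 2 * A * k%:~R) (C + B * k%:~R + A * k%:~R
    ^+ 2)
    a (b + 3 * a * k) (c + 2 * b * k + 3 * a * k ^+ 2)
      (d + c * k + b * k ^+ 2 + a * k ^+ 3).
Proof.
move=> [ea eb ec ed].
split=> //.
- by transitivity (b%:~R + 3 * a%:~R * k%:~R : R); [ring | rewrite ea eb; ring].
- transitivity (c%:~R + 2 * b%:~R * k%:~R + 3 * a%:~R * k%:~R ^+ 2 : R);
  first by ring.
  by rewrite ea eb ec; ring.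
- transitivity (d%:~R + c%:~R * k%:~R + b%:~R * k%:~R ^+ 2 + a%:~R * k%:~R ^+ 3
  : R).
    by ring.
  by rewrite ea eb ec ed; ring.
Qed.

(* The swap is only applied when it shrinks [A] by a definite factor, so that
   the reduction of the definite quadratic factor terminates. *)
Lemma splits_reduce al be A B C a b c d : splits al be A B C a b c d ->
    T a b c d -> 0 < A -> B ^+ 2 < 4 * A * C ->
  exists al' be' A' B' C' a' b' c' d', [/\ splits al' be' A' B' C' a' b' c' d',
    T a' b' c' d', cubic_disc a' b' c' d' = cubic_disc a b c d
    & [/\ 0 < A', `|B'| <= A' & 97 * A' <= 100 * C']].
Proof.
move=> sp t A0 D0; set D := 4 * A * C - B ^+ 2.
have Dp : 0 < D by rewrite subr_gt0.
(* The quantity D = 4 A C - B^2 is invariant. When 100 C < 97 A it forces m <= A, so replacing A by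
   C loses at least 3 m / 100; this bounds the number of swaps by [n]. Once A <= m, the inequality A
   <= C is automatic. *)
pose m := Num.sqrt (D / 4); have m0 : 0 < m by rewrite sqrtr_gt0; lra.
have m2 : m ^+ 2 = D / 4 by rewrite sqr_sqrtr //; lra.
have [n An] : exists n : nat, A <= m + n%:R * (m * 3 / 100).
  exists (Num.bound (A / (m * 3 / 100))).
  have e0 : 0 < m * 3 / 100 by lra.
  have := archi_boundP (ltW (divr_gt0 A0 e0)); rewrite ltr_pdivrMr //; lra.
have DE : 4 * A * C - B ^+ 2 = D by [].
clearbody m; clearbody D; clear D0.
elim: n => [|n IH] in al be A B C a b c d sp t A0 An DE *;
  have [k] := real_round B A0; move/(splits_shift k): sp => sp;
  have {}t := orbit_shift orbT k t; rewrite -(cubic_disc_shift k a b c d);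
  move: DE; rewrite -(_ : 4 * A * (C + B * k%:~R + A * k%:~R ^+ 2)
    - (B + 2 * A * k%:~R) ^+ 2 = 4 * A * C - B ^+ 2); do ?ring;
  move: {be B C b c d} (be + _) (B + _) (C + _ + _) (b + _) (c + _ + _)
    (d + _ + _ + _) sp t => be B C b c d sp t DE BA.
  exists al, be, A, B, C, a, b, c, d; split=> //; split=> //.
  rewrite mul0r addr0 in An.
  have B2 : B ^+ 2 <= A ^+ 2 by move: BA; rewrite ler_norml => /andP[? ?]; nra.
  have A2 : A ^+ 2 <= m ^+ 2 by nra.
  have : A <= C by rewrite -(ler_pM2l A0); nra.
  lra.
have [le|lt] := leP (97 * A) (100 * C).
  by exists al, be, A, B, C, a, b, c, d; split.
have sp' : splits be al C B A d c b a.
  by case: sp => ea eb ec ed; split; rewrite ?(ea, eb, ec, ed) // addrC.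
rewrite -cubic_disc_swap.
have C0 : 0 < C by rewrite -(pmulr_rgt0 _ A0); have := sqr_ge0 B; lra.
have mA : m <= A.
  by rewrite -(@ler_pXn2r _ 2) ?nnegrE ?ltW // m2; have := sqr_ge0 B; nra.
apply: (IH be al C B A d c b a) => //.   exact: (orbit_swap orbT t).
  move: An; rewrite -natr1 mulrDl mul1r; lra.
by rewrite -DE; ring.
Qed.

Lemma int_norm_le (z m : int) :
  - (m%:~R + 1) < (z%:~R : R) < m%:~R + 1 -> `|z| <= m.
Proof.
rewrite -[m%:~R + 1](intrD R m 1) -rmorphN !ltr_int => /andP[h1 h2].
by rewrite ler_norml; lia.
Qed.

(* [97 / 100] is close enough to 1 for [-23 <= disc] to force [a = 1]. *)
Lemma reduced_bounds al be A B C a b c d : splits al be A B C a b c d ->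
    0 < al -> 0 < A -> `|B| <= A -> 97 * A <= 100 * C ->
    -23 <= cubic_disc a b c d ->
  [/\ a = 1, `|b| <= 3, `|c| <= 5 & `|d| <= 6].
Proof.
move=> sp al0 A0 BA CA; rewrite -(ler_int R) (splits_disc sp).
(* Scaling the linear factor to X + x Y turns the leading coefficient of the quadratic factor into
   [a]. *)
have [x xE] : exists x, be = x * al by exists (be / al); rewrite divfK ?gt_eqF.
case: sp; rewrite {}xE.
have -> : (B ^+ 2 - 4 * A * C) * (A * (x * al) ^+ 2 - B * (x * al) * al + C * al
  ^+ 2) ^+ 2
  = ((al * B) ^+ 2 - 4 * (al * A) * (al * C))
      * ((al * A) * x ^+ 2 - (al * B) * x + (al * C)) ^+ 2 by ring.
move=> ea + + + D23; rewrite -ea in D23 *.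
have -> : x * al * A = x * (al * A) by ring.
have -> : x * al * B = x * (al * B) by ring.
have -> : x * al * C = x * (al * C) by ring.
rewrite -ea; have {}BA : `|al * B| <= a%:~R.
  by rewrite normrM (ger0_norm (ltW al0)) ea ler_pM2l.
have {}CA : 97 * a%:~R <= 100 * (al * C).
  by rewrite ea mulrCA (mulrCA _ al) ler_pM2l.
have {A0} : (1 : R) <= a%:~R.
  by rewrite (ler_int R 1) -gtz0_ge1 -(ltr_int R) ea mulr_gt0.
move: {ea al0} D23 BA CA; set B1 := al * B; set C1 := al * C.
move: B1 C1 => {al A B C} B C D23 BA CA a1 eb ec ed.
(* [D] is minus the discriminant of the quadratic factor and [u ^+ 2 + D] is 4 a times the
   resultant. Hence D (u^2 + D)^2 = - 16 a^2 disc, and 368 = 16 * 23. *)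
pose D := 4 * a%:~R * C - B ^+ 2; pose u := 2 * a%:~R * x - B.
have uD : D * (u ^+ 2 + D) ^+ 2 <= 368 * a%:~R ^+ 2.
  rewrite (_ : D * _ = - (16 * a%:~R ^+ 2 * ((B ^+ 2 - 4 * a%:~R * C) * (a%:~R *
    x ^+ 2 - B * x + C) ^+ 2))).
    have := sqr_ge0 (a%:~R : R); move: D23; rewrite (_ : (-23)%:~R = -23 :> R)
      //; nra.
  by rewrite /D /u; ring.
have B2 : B ^+ 2 <= a%:~R ^+ 2.
  by move: BA; rewrite ler_norml => /andP[? ?]; nra.
have Dlow : 288 * a%:~R ^+ 2 <= 100 * D by rewrite /D; nra.
have D0 : 0 < D by have : 1 <= (a%:~R : R) ^+ 2 by [nra]; nra.
have uD2 : 9 * (u ^+ 2 + D) ^+ 2 <= 1150.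
  have a20 : 0 < (a%:~R : R) ^+ 2 by nra.
  rewrite -(ler_pM2r a20); have := sqr_ge0 (u ^+ 2 + D); nra.
have u20 := sqr_ge0 u.
have aE : a = 1.
  (* For a >= 2, [Dlow] gives D >= 288 / 25, whose square exceeds the bound 1150 / 9 of [uD2]. *)
  apply/eqP; rewrite eq_le -[1 <= a](ler_int R) a1 andbT -ltzD1 -(ltr_int R).
  rewrite ltNge; apply/negP => a2; have {}a2 : 2 <= a%:~R :> R by [].
  have : 4 <= (a%:~R : R) ^+ 2 by nra.
  by nra.
rewrite aE in a1 eb ec ed D Dlow D0 u uD2 B2 BA uD u20 *.
have {aE} uDle : u ^+ 2 + D <= 12 by nra.
have u1 : -31 / 10 <= u <= 31 / 10 by apply/andP; split; nra.
have B1 : -1 <= B <= 1 by rewrite -ler_norml.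
have xE : x = (u + B) / 2 by rewrite /u; field.
have C1 : 0 <= C <= 13 / 4.
  have CE : C = (D + B ^+ 2) / 4 by rewrite /D; field.
  by rewrite CE; have := sqr_ge0 B; lra.
have x1 : -21 / 10 <= x <= 21 / 10 by rewrite xE; lra.
clear D23 BA a1 D Dlow D0 u uD uDle B2 u20 u1 xE uD2.
have xB : -21 / 10 <= x * B <= 21 / 10 by apply/andP; split; nra.
have xC : - 7 < x * C < 7 by apply/andP; split; nra.
split; first exact: erefl; apply: int_norm_le.
- by rewrite eb; lra.
- by rewrite ec; lra.
- by rewrite ed; lra.
Qed.
Lemma cubic_disc_neg a b c d : T a b c d -> cubic_disc a b c d < 0 ->
    -23 <= cubic_disc a b c d ->
  exists b' c' d', [/\ T 1 b' c' d', cubic_disc 1 b' c' d' = cubic_disc a b c d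
    & [/\ `|b'| <= 3, `|c'| <= 5 & `|d'| <= 6]].
Proof.
move=> t D0 D23; have a0 := orbit_neq0 orbT t.
have a0R : (a%:~R : R) != 0 by rewrite intr_eq0.
have [x rx] := cubic_root (b%:~R / a%:~R) (c%:~R / a%:~R) (d%:~R / a%:~R).
have [al [be [A [B [C [sp A0 BAC]]]]]] : exists al be A B C,
    [/\ splits al be A B C a b c d, 0 < A & B ^+ 2 < 4 * A * C].
  pose B : R := b%:~R + a%:~R * x; pose C := c%:~R + B * x.
  have dE : d%:~R = - x * C.
    move/(congr1 ( *%R a%:~R)): rx; rewrite mulr0 => rx.
    apply/eqP; rewrite -subr_eq0 -rx /C /B; apply/eqP; field; exact: a0R.
  have sp : splits 1 (- x) a%:~R B C a b c d.
    by split=> //; rewrite /C /B; ring.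
  have BAC : B ^+ 2 < 4 * a%:~R * C.
    rewrite -subr_lt0; have : ((cubic_disc a b c d)%:~R : R) < 0 by rewrite
      ltrz0.
    rewrite (splits_disc sp); apply: contraLR; rewrite -!leNgt => h.
    by rewrite mulr_ge0 ?sqr_ge0.
  have [aneg|apos|/eqP] := ltgtP (a%:~R : R) 0; last by rewrite (negPf a0R).
    exists (-1), x, (- a%:~R), (- B), (- C); split; rewrite ?oppr_gt0 //.
      by case: sp => ea eb ec ed; split; rewrite ?(eb, ec, ed); ring.
    by move: BAC; congr (is_true (_ < _)); ring.
  by exists 1, (- x), a%:~R, B, C.
have [al' [be' [A' [B' [C' [a' [b' [c' [d']]]]]]]]] := splits_reduce sp t A0
  BAC.
move=> {sp t A0 BAC} [sp t DE [A0 BA CA]]; rewrite -{}DE in D0 D23 *.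
have [alN|alP|al0] := ltgtP al' 0; last first.
- case: sp => /eqP; rewrite al0 mul0r intr_eq0 => a0'.
  by have := orbit_neq0 orbT t; rewrite a0'.
- have [aE b3 c5 d6] := reduced_bounds sp alP A0 BA CA D23.
  by move: t; rewrite aE => t; exists b', c', d'.
have sp' : splits (- al') (- be') A' B' C' (- a') (- b') (- c') (- d').
  by case: sp => ea eb ec ed; split; rewrite rmorphN /= ?(ea, eb, ec, ed); ring.
have DE : cubic_disc (- a') (- b') (- c') (- d') = cubic_disc a' b' c' d'.
  by rewrite /cubic_disc; ring.
rewrite -DE in D23 *; have alN' : 0 < - al' by rewrite oppr_gt0.
have [aE b3 c5 d6] := reduced_bounds sp' alN' A0 BA CA D23.
have := orbit_opp orbT t; rewrite aE => t'.
by exists (- b'), (- c'), (- d').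
Qed.

End NegativeDiscriminant.

(* Multiplication in the basis [1, w, w^2] when [w^3 = b w^2 - c w + d]. *)
Definition cubic_mul (b c d : int) (p q : int * int * int) : int * int * int :=
  let: (p0, p1, p2) := p in let: (q0, q1, q2) := q in
  let r4 := p2 * q2 in let r3 := p1 * q2 + p2 * q1 + b * r4 in
  (p0 * q0 + d * r3, p0 * q1 + p1 * q0 + d * r4 - c * r3,
   p0 * q2 + p1 * q1 + p2 * q0 - c * r4 + b * r3).

Definition cubic_eval (K : pzRingType) (w : K) (p : int * int * int) : K :=
  p.1.1%:~R + p.1.2%:~R * w + p.2%:~R * w ^+ 2.

Lemma cubic_evalM (K : comPzRingType) (w : K) (b c d : int) p q :
  w ^+ 3 = b%:~R * w ^+ 2 - c%:~R * w + d%:~R ->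
  cubic_eval w (cubic_mul b c d p q) = cubic_eval w p * cubic_eval w q.
Proof.
case: p => [[p0 p1] p2]; case: q => [[q0 q1] q2] h; rewrite /cubic_eval /=.
apply/eqP; rewrite -subr_eq0; apply/eqP.
transitivity (((p1 * q2 + p2 * q1 + b * (p2 * q2))%:~R + (p2 * q2)%:~R * w)
  * (b%:~R * w ^+ 2 - c%:~R * w + d%:~R - w ^+ 3)); first by ring.
by rewrite h subrr mulr0.
Qed.

(* [t] represents a root of [x^3 - x^2 + 1]. *)
Definition is_K1_root b c d t :=
  let s := cubic_mul b c d t t in let r := cubic_mul b c d s t in
  [&& r.1.1 - s.1.1 + 1 == 0, r.1.2 == s.1.2 & r.2 == s.2].

Lemma is_K1_rootP (K : comPzRingType) (w : K) (b c d : int) t :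
    w ^+ 3 = b%:~R * w ^+ 2 - c%:~R * w + d%:~R -> is_K1_root b c d t ->
  let be := cubic_eval w t in be ^+ 3 = be ^+ 2 - 1.
Proof.
move=> h /and3P[/eqP e0 /eqP e1 /eqP e2] be.
rewrite exprSr expr2 /be -!(cubic_evalM _ _ h) /cubic_eval e1 e2.
set s := (cubic_mul _ _ _ t t) in e0 *; set r := cubic_mul _ _ _ s t in e0 *.
have -> : r.1.1 = s.1.1 - 1 by apply/eqP; rewrite -subr_eq0 opprB addrA addrAC
  e0.
by rewrite rmorphB /=; ring.
Qed.

Definition centered_range n : seq int := [seq i%:Z - n%:Z | i <- iota 0
  (n.*2).+1].

Lemma mem_centered_range n (z : int) : `|z| <= n%:Z -> z \in centered_range n.
Proof.
move=> zn; apply/mapP; exists (absz (z + n%:Z)).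
  by rewrite mem_iota add0n /= -addnn; lia.
by lia.
Qed.

(** A finite check over the box of reduced coefficients. Nonzero integer roots divide d, so
    reducible cubics are recognised by a root of absolute value at most 6. *)
Lemma small_cubics b c d : `|b| <= 3 -> `|c| <= 5 -> `|d| <= 6 ->
    -23 <= cubic_disc 1 b c d < 0 ->
    (forall x, x ^+ 3 - b * x ^+ 2 + c * x - d != 0) ->
  cubic_disc 1 b c d = -23 /\ exists t, is_K1_root b c d t.
Proof.
(* Coordinates on 1, w, w^2 of roots of x^3 - x^2 + 1: each cubic that survives the other tests
   admits one of these triples. *)
pose roots : seq (int * int * int) :=
  [:: (0, -2, -1); (-1, 3, 1); (1, 1, 0); (-1, -1, -1); (-3, -1, 1);
      (0, -1, 0); (1, 0, -1); (-3, 1, 1); (0, 1, 0); (-1, 1, -1);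
      (-1, -3, 1); (1, -1, 0); (0, 2, -1)].
have check : all (fun b => all (fun c => all (fun d =>
    [|| cubic_disc 1 b c d < -23, 0 <= cubic_disc 1 b c d,
      has (fun x => x ^+ 3 - b * x ^+ 2 + c * x - d == 0) (centered_range 6)
    | (cubic_disc 1 b c d == -23) && has (is_K1_root b c d) roots])
   (centered_range 6)) (centered_range 5)) (centered_range 3).
  by vm_compute.
move=> /(@mem_centered_range 3) b3 /(@mem_centered_range 5) c5.
move=> /(@mem_centered_range 6) d6 /andP[D1 D2] nr.
have h := allP (allP (allP check b b3) c c5) d d6; move: h; cbv beta.
rewrite (ltNge _ (-23)) D1 (leNgt 0) D2 !orFb => /orP[/hasP[x _]|/andP[/eqP->
  /hasP[t _ rt]]].
  by rewrite (negPf (nr x)).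
by split; [exact: erefl | exists t].
Qed.

Lemma small_cubic_orbit a b c d : T a b c d ->
    (forall b' c' d' x, T 1 b' c' d' -> x ^+ 3 - b' * x ^+ 2 + c' * x - d' != 0)
      ->
    cubic_disc a b c d != 0 -> `|cubic_disc a b c d| <= 23 ->
  cubic_disc a b c d = -23 /\
  exists b' c' d' t, T 1 b' c' d' /\ is_K1_root b' c' d' t.
Proof.
move=> t nr D0 D23; have [Dn|Dp|D0'] := ltgtP (cubic_disc a b c d) 0.
- have D1 : -23 <= cubic_disc a b c d by move: D23;
  rewrite ler_norml => /andP[].
  have [b' [c' [d' [t' DE [b3 c5 d6]]]]] := cubic_disc_neg realalg t Dn D1.
  rewrite -DE in D1 Dn *.
  have [|->  [u ru]] := small_cubics b3 c5 d6 _ (fun x => nr b' c' d' x t');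
    first by rewrite D1.
  by split=> //; exists b', c', d', u.
- by have := cubic_disc_pos t Dp; rewrite ltNge -{1}(gtr0_norm Dp) D23.
- by rewrite D0' in D0.
Qed.

End BinaryCubicForms.

(** * Rings of integers of cubic fields *)

Section Gram.
Variable L : fieldExtType rat.

Definition gram_disc m (b : m.-tuple L) : rat :=
  \det (\matrix_(i < m, j < m) field_trace (tnth b i * tnth b j)).

Lemma gram_disc_change m (b b' : m.-tuple L) (M : 'M[rat]_m) :
    (forall i, tnth b' i = \sum_j M i j *: tnth b j) ->
  gram_disc b' = \det M ^+ 2 * gram_disc b.
Proof.
move=> bE; rewrite /gram_disc; set G := (X in _ = _ * \det X).
have -> : \matrix_(i, j) field_trace (tnth b' i * tnth b' j) = M *m G *m M^T.
  apply/matrixP => i j; rewrite !mxE bE bE mulr_suml linear_sum /=.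
  transitivity (\sum_k \sum_l M i k * M j l * field_trace (tnth b k * tnth b
    l)).
    apply: eq_bigr => k _; rewrite mulr_sumr linear_sum;
      apply: eq_bigr => l _ /=.
    by rewrite -scalerAl -scalerAr !linearZ /= mulrA.
  rewrite exchange_big; apply: eq_bigr => l _; rewrite !mxE mulr_suml.
  by apply: eq_bigr => k _; rewrite !mxE; ring.
by rewrite !det_mulmx det_tr; ring.
Qed.

(** The trace form is nondegenerate: a nonzero x orthogonal to everything would make the trace of x
    x^-1 vanish, but this trace is the degree. *)
Lemma gram_disc_neq0 m (b : m.-tuple L) : basis_of {:L} b -> gram_disc b != 0.
Proof.
move=> bb; apply/negP => /det0P[v v0 vG].
pose x := \sum_i v 0 i *: tnth b i.
have bE (i : 'I_m) : b`_i = tnth b i by rewrite (tnth_nth 0).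
have x0 : x != 0.
  apply: contra v0 => /eqP x0; apply/eqP/rowP => i; rewrite mxE.
  have /freeP fr := basis_free bb; apply: (fr (v 0)); rewrite -[RHS]x0.
  by apply: eq_bigr => j _; rewrite bE.
have xt y : field_trace (x * y) = 0.
  rewrite (coord_basis bb (memvf y)) mulr_sumr linear_sum big1 // => j _.
  rewrite -scalerAr linearZ /= bE mulr_suml linear_sum /=.
  move/rowP: vG => /(_ j); rewrite !mxE => h.
  rewrite (eq_bigr (fun i => v 0 i * (\matrix_(i,
    j) field_trace (tnth b i * tnth b j)) i j)).
    by rewrite h mulr0.
  by move=> i _; rewrite !mxE -scalerAl linearZ.
have := xt x^-1; rewrite divff // -[1]scale1r trace_alg => /eqP.
by rewrite pnatr_eq0 eqn0Ngt adim_gt0.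
Qed.

(** [integral_basis] with a free length, so that tuples of length 3 can be used although [\dim {:L}]
    equals 3 only propositionally. *)
Definition zbasis m (b : m.-tuple L) : Prop :=
  basis_of {:L} b /\
  forall x : L, integralOver (intr : int -> L) x <->
    exists c : 'I_m -> int, x = \sum_(i < m) tnth b i *~ c i.

(** The two changes of basis have integral determinants y and z with z^2 y^2 = 1, and the
    discriminant is multiplied by y^2. *)
Lemma zbasis_disc m (b b' : m.-tuple L) : zbasis b -> zbasis b' ->
  gram_disc b' = gram_disc b.
Proof.
move=> [bb bi] [bb' bi'].
have cM (u w : m.-tuple L) : (forall x : L, integralOver (intr : int -> L) x <->
    exists c : 'I_m -> int, x = \sum_(i < m) tnth u i *~ c i) ->
    (forall x : L, integralOver (intr : int -> L) x <->
    exists c : 'I_m -> int, x = \sum_(i < m) tnth w i *~ c i) ->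
    exists z : int, gram_disc w = z%:~R ^+ 2 * gram_disc u.
  move=> ui wi; have wu i : exists c : 'I_m -> int,
    tnth w i = \sum_(j < m) tnth u j *~ c j.
    apply/ui/wi; exists (fun j => (i == j)%:Z);
      rewrite (bigD1 i) //= eqxx mulr1z.
    by rewrite big1 ?addr0 // => j; rewrite eq_sym => /negPf ->; rewrite mulr0z.
  have [c cE] := fin_all_exists wu.
  exists (\det (\matrix_(i, j) c i j)).
  rewrite (@gram_disc_change _ u w (map_mx intr (\matrix_(i, j) c i j))).
    by rewrite det_map_mx.
  by move=> i; rewrite cE; apply: eq_bigr => j _; rewrite !mxE scaler_int.
have [y yE] := cM _ _ bi bi'; have [z zE] := cM _ _ bi' bi.
have d0 := gram_disc_neq0 bb.
have zy : z ^+ 2 * y ^+ 2 = 1.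
  apply: (@intr_inj rat); rewrite rmorphM !rmorphXn /=.
  by apply: (mulIf d0); rewrite mul1r -mulrA -yE -zE.
have /orP[/eqP y2|/eqP y2] : (y ^+ 2 == 1) || (y ^+ 2 == -1).
  by have := intUnitRing.unitzPl zy; rewrite qualifE.
  by rewrite yE -rmorphXn /= y2 mul1r.
by have := sqr_ge0 y; rewrite y2.
Qed.

Lemma field_discE m (b : m.-tuple L) : m = \dim {:L} -> zbasis b ->
  field_disc L = gram_disc b.
Proof.
move=> dm; subst m => zb; apply: classical_sets.xget_unique; first by exists b.
by move=> _ [b' zb' ->]; apply: zbasis_disc zb zb'.
Qed.

End Gram.

Lemma det_mx33 (R : comPzRingType) (g : nat -> nat -> R) :
  \det (\matrix_(i < 3, j < 3) g i j) =
    g 0%N 0%N * (g 1%N 1%N * g 2%N 2%N - g 1%N 2%N * g 2%N 1%N) - g 0%N 1%N * (g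
      1%N 0%N * g 2%N 2%N - g 1%N 2%N * g 2%N 0%N)
    + g 0%N 2%N * (g 1%N 0%N * g 2%N 1%N - g 1%N 1%N * g 2%N 0%N).
Proof.
rewrite (expand_det_row _ ord0) !big_ord_recl big_ord0 /cofactor.
rewrite !(expand_det_row _ ord0) !big_ord_recl !big_ord0 /cofactor !det_mx11
  !mxE /=.
rewrite -[bump 0 0]/1%N -[bump 0 1]/2%N -[bump 1 0]/0%N -[bump 1 1]/2%N
  -[bump 2 0]/0%N -[bump 2 1]/1%N.
ring.
Qed.

(** * Integral bases of cubic fields and their cubic forms *)

Section CubicIntegralBasis.
Variable L : fieldExtType rat.
Hypothesis dimL : \dim {:L} = 3%N.
Implicit Types u v w x : L.
Local Notation integral := (integralOver (intr : int -> L)).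

Definition disc3 u v : rat := gram_disc [tuple 1; u; v].

Lemma disc3E u v : disc3 u v =
  3 * (field_trace (u * u) * field_trace (v * v) - field_trace (u * v) ^+ 2)
  - field_trace u * (field_trace u * field_trace (v * v) - field_trace (u * v) *
    field_trace v)
  + field_trace v * (field_trace u * field_trace (u * v) - field_trace (u * u) *
    field_trace v).
Proof.
rewrite /disc3 /gram_disc.
have -> : \matrix_(i < 3, j < 3) field_trace (tnth [tuple 1; u;
  v] i * tnth [tuple 1; u; v] j)
  = \matrix_(i < 3, j < 3) field_trace ([:: 1; u; v]`_i * [:: 1; u; v]`_j).
  by apply/matrixP => i j; rewrite !mxE !(tnth_nth 0).
rewrite (det_mx33 (fun i j => field_trace ([:: 1; u; v]`_i * [:: 1; u;
  v]`_j))) /=.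
rewrite !mul1r !mulr1 (mulrC v u) -[1 : L]scale1r trace_alg dimL.
by ring.
Qed.

Lemma disc3_change u v u' v' (a0 a1 a2 b0 b1 b2 : rat) :
    u' = a0 *: 1 + a1 *: u + a2 *: v -> v' = b0 *: 1 + b1 *: u + b2 *: v ->
  disc3 u' v' = (a1 * b2 - a2 * b1) ^+ 2 * disc3 u v.
Proof.
move=> eu ev.
pose g (i j : nat) := nth 0 (nth [::] [:: [:: 1; 0; 0]; [:: a0; a1; a2];
  [:: b0; b1; b2]] i) j.
rewrite /disc3 (@gram_disc_change _ _ [tuple 1; u; v] _ (\matrix_(i, j) g i j)).
  by rewrite det_mx33 /g /=; ring.
case=> -[|[|[|//]]] lt; rewrite !big_ord_recr big_ord0 /= !mxE /g /= !(tnth_nth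
  0) /= add0r.
- by rewrite scale1r !scale0r !addr0.
- exact: eu.
- exact: ev.
Qed.

Definition int_comb u v x := exists a b c : int,
  x = a%:~R + b%:~R * u + c%:~R * v.

Definition int_basis3 u v :=
  basis_of {:L} [:: 1; u; v] /\ forall x, integral x <-> int_comb u v x.

Lemma int_basis3_integral u v : int_basis3 u v -> integral u /\ integral v.
Proof.
move=> [_ h]; split; apply/h; [exists 0, 1, 0 | exists 0, 0, 1];
  by rewrite !(mul0r, mul1r, add0r, addr0).
Qed.

Lemma int_basis3_zbasis u v : int_basis3 u v ->
  field_disc L = disc3 u v.
Proof.
move=> [bu iu]; have zb : zbasis [tuple 1; u; v].
  split=> // x; apply: iff_trans (iu x) _; split=> [[a [b [c ->]]]|[c ->]].
    exists (fun i => [:: a; b; c]`_i); rewrite !big_ord_recr big_ord0 /= add0r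
      !(tnth_nth 0) /=.
    by rewrite !mulrzl.
  exists (c 0), (c 1), (c 2%:R); rewrite !big_ord_recr big_ord0 /= add0r
    !(tnth_nth 0) /=.
  by rewrite !mulrzl; congr (_ *~ c _ + _ *~ c _ + _ *~ c _); apply: val_inj.
by apply: field_discE zb; rewrite dimL.
Qed.

Lemma disc3_neq0 u v : basis_of {:L} [:: 1; u; v] -> disc3 u v != 0.
Proof. exact: (@gram_disc_neq0 _ _ [tuple 1; u; v]). Qed.

Lemma disc3_int u v : integral u -> integral v -> exists z : int,
  disc3 u v = z%:~R.
Proof.
move=> iu iv; rewrite disc3E.
have [a ->] := trace_integral dimL iu; have [b ->] := trace_integral dimL iv.
have [c ->] := trace_integral dimL (integral_mul iu iu).
have [d ->] := trace_integral dimL (integral_mul iu iv).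
have [e ->] := trace_integral dimL (integral_mul iv iv).
exists (3 * (c * e - d ^+ 2) - a * (a * e - d * b) + b * (a * d - c * b)); ring.
Qed.

Lemma integral_comb a b c u v : integral u -> integral v ->
  integral (a%:~R + b%:~R * u + c%:~R * v).
Proof.
have intz (z : int) : integral z%:~R by apply: (integral_id (intr : {rmorphism
  int -> L})).
move=> iu iv; apply: integral_add; first apply: integral_add => //.
  exact: integral_mul.
exact: integral_mul.
Qed.

Lemma basis3_of_span u v u' v' : basis_of {:L} [:: 1; u; v] ->
    u \in <<[:: 1%R; u'; v']>>%VS -> v \in <<[:: 1%R; u'; v']>>%VS ->
  basis_of {:L} [:: 1; u'; v'].
Proof.
move=> /span_basis bu iu iv; rewrite basisEdim dimL leqnn andbT -bu.
apply/span_subvP => x; rewrite !inE => /or3P[] /eqP-> //.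
by rewrite memv_span // inE eqxx.
Qed.

Lemma scaler_intr (z : int) x : (z%:~R : rat) *: x = z%:~R * x.
Proof. by rewrite scaler_int mulrzl. Qed.

Lemma intrL_neq0 (z : int) : z != 0 -> (z%:~R : L) != 0.
Proof. by move=> z0; rewrite -scaler_int scaler_eq0 oner_eq0 orbF intr_eq0. Qed.

Lemma scaler_frac (a z : int) x : a != 0 ->
  ((a%:~R : rat)^-1 * z%:~R) *: x = (a%:~R)^-1 * (z%:~R * x).
Proof.
move=> a0; have aQ : (a%:~R : rat) != 0 by rewrite intr_eq0.
rewrite -scalerA scaler_intr; apply: (scalerI aQ).
by rewrite scalerKV // scaler_intr mulVKf // intrL_neq0.
Qed.

(* Reducing the coordinates of an integral element modulo 1 lowers the
   discriminant by the square of a fractional part. *)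
Lemma disc3_descent u v : basis_of {:L} [:: 1; u;
  v] -> integral u -> integral v ->
  int_basis3 u v \/ exists u' v', [/\ basis_of {:L} [:: 1; u'; v'], integral u',
    integral v' & `|disc3 u' v'| < `|disc3 u v|].
Proof.
move=> bu iu iv; have d0 := disc3_neq0 bu.
have [h|/boolp.existsNP[x /boolp.not_implyP[ix nx]]] :=
    boolp.pselect (forall x, integral x -> int_comb u v x).
  left; split=> // x; split=> [/h//|[a [b [c ->]]]]; exact: integral_comb.
right; have [r0 [r1 [r2 xE]]] := indep3_span dimL x (iffRL (indep3_basis dimL 1
  u v) bu).
pose frac (r : rat) := r - (Num.floor r)%:~R.
have fr r : 0 <= frac r < 1.
  by have := floor_itv r; rewrite /frac rmorphD /=; lra.
pose y := x + ((- Num.floor r0)%:~R + (- Num.floor r1)%:~R * u + (- Num.floor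
  r2)%:~R * v).
have iy : integral y by apply: integral_add ix (integral_comb _ _ _ iu iv).
have yE : y = frac r0 *: 1 + frac r1 *: u + frac r2 *: v.
  rewrite /y xE /frac !scalerBl !scaler_intr !rmorphN /= mulr1; ring.
have drop s : 0 <= s < 1 -> s != 0 -> `|s ^+ 2 * disc3 u v| < `|disc3 u v|.
  move=> /andP[s0 s1] sn; rewrite normrM gtr_pMl ?normr_gt0 // ger0_norm
    ?sqr_ge0 //.
  by rewrite expr_lt1.
have [f1|f1] := eqVneq (frac r1) 0; last first.
  exists y, v; split=> //; last first.
    by rewrite (disc3_change (u := u) (v := v) yE (b0 := 0) (b1 := 0) (b2 :=
      1));
      rewrite ?mulr1 ?mulr0 ?subr0 ?drop // !scale0r scale1r !add0r.
  apply: (basis3_of_span bu); last by rewrite memv_span // !inE eqxx !orbT.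
  have -> : u = (frac r1)^-1 *: (y - frac r0 *: 1 - frac r2 *: v).
    apply: (canRL (scalerK f1)); rewrite yE; ring.
  by rewrite memvZ // !memvB // ?memvZ // memv_span // !inE eqxx ?orbT.
have [f2|f2] := eqVneq (frac r2) 0; last first.
  exists u, y; split=> //; last first.
    by rewrite (disc3_change (u := u) (v := v) (a0 := 0) (a1 := 1) (a2 := 0) _
      yE);
      rewrite ?mul1r ?mul0r ?subr0 ?drop // !scale0r scale1r addr0 add0r.
  apply: (basis3_of_span bu); first by rewrite memv_span // !inE eqxx !orbT.
  have -> : v = (frac r2)^-1 *: (y - frac r0 *: 1 - frac r1 *: u).
    apply: (canRL (scalerK f2)); rewrite yE; ring.
  by rewrite memvZ // !memvB // ?memvZ // memv_span // !inE eqxx ?orbT.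
case: nx; move: (yE) iy; rewrite f1 f2 !scale0r !addr0 => -> /(@integral_rat
  L)[z zE].
have z0 : z = 0.
  have := fr r0; rewrite zE (ler_int _ 0) (ltr_int _ _ 1); lia.
exists (Num.floor r0), (Num.floor r1), (Num.floor r2).
apply/eqP; rewrite -subr_eq0; apply/eqP; transitivity y.
  by rewrite /y !rmorphN /=; ring.
by rewrite yE f1 f2 zE z0 !scale0r !addr0.
Qed.

(** The powers of an integral multiple of a generator form a first basis; the descent stops because
    discriminants of integral bases are integers. *)
Lemma int_basis3_exists : exists u v, int_basis3 u v.
Proof.
have [u [v [bu iu iv]]] : exists u v, [/\ basis_of {:L} [:: 1; u; v],
  integral u & integral v].
  have [x nx] : exists x : L, x \notin 1%VS.
    apply: boolp.contrapT => h; have : (fullv <= (1%VS : {vspace L}))%VS.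
      by apply/subvP => x _; apply: contraT => nx; case: h; exists x.
    by move/dimvS; rewrite dimL dimv1.
  have [q [mq sq rq _]] := cubic_minpoly dimL nx.
  have [p [a a0 qE]] := rat_poly_scale q.
  have qi i : q`_i = (a%:~R)^-1 * (p`_i)%:~R by rewrite qE coefZ coef_map.
  have := rootP rq; rewrite horner4 // !qi => ex.
  have aL := intrL_neq0 a0.
  pose y := a%:~R * x.
  have ny : y \notin 1%VS.
    apply: contra nx => yin; rewrite -(mulKf aL x) rpredM // rpredV.
    by rewrite -scaler_int rpredZ // mem1v.
  have iy : integral y.
    (* Multiplying by a^3 the monic equation of x, whose coefficients have denominator a, gives an
       equation for y = a x. *)
    exists (Poly [:: a ^+ 2 * p`_0; a * p`_1; p`_2; 1]).
      by rewrite monicE /lead_coef (PolyK (c := 0)).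
    rewrite map_Poly_id0 // rootE horner_Poly /= -[X in _ == X](mulr0 (a%:~R ^+
      3)) -[in X in _ == X]ex.
    rewrite !scaler_frac // /y; apply/eqP; field; exact: aL.
  exists y, (y ^+ 2); split=> //.
    by rewrite -indep3_basis //; apply: indep3_powers.
  exact: integral_mul.
have [z zE] := disc3_int iu iv.
move: {-1}`|z|%N (leqnn `|z|%N) => n.
elim/ltn_ind: n u v z zE bu iu iv => n IH u v z zE bu iu iv zn.
have [|[u' [v' [bu' iu' iv' lt]]]] := disc3_descent bu iu iv;
  first by exists u, v.
have [z' zE'] := disc3_int iu' iv'.
apply: (IH `|z'|%N _ u' v' z') => //; apply: leq_trans zn.
by move: lt; rewrite zE zE' -!intr_norm ltr_int; lia.
Qed.

(* The multiplication table attached to a binary cubic form by the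
   Delone-Faddeev correspondence. *)
Definition mul_table u v (a b c d : int) :=
  [/\ u ^+ 2 = - (a * c)%:~R + b%:~R * u - a%:~R * v,
      u * v = - (a * d)%:~R
    & v ^+ 2 = - (b * d)%:~R + d%:~R * u - c%:~R * v].

Definition ring_form a b c d :=
  exists u v, int_basis3 u v /\ mul_table u v a b c d.

Lemma int_comb_trans u v u' v' x : int_comb u v u' -> int_comb u v v' ->
  int_comb u' v' x -> int_comb u v x.
Proof.
move=> [i [j [k ->]]] [l [m [n ->]]] [a [b [c ->]]].
exists (a + b * i + c * l), (b * j + c * m), (b * k + c * n); ring.
Qed.

Lemma int_basis3_change u v u' v' : int_basis3 u v ->
    int_comb u v u' -> int_comb u v v' -> int_comb u' v' u -> int_comb u' v' v
      ->
  int_basis3 u' v'.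
Proof.
move=> [bu iu] cu' cv' cu cv; split; last first.
  by move=> x; split=> [/iu|] h; [|apply/iu]; apply: int_comb_trans h.
have span x : int_comb u' v' x -> x \in <<[:: 1%R; u'; v']>>%VS.
  move=> [a [b [c ->]]]; rewrite -[a%:~R]mulr1 -!scaler_intr.
  by rewrite !memvD // memvZ // memv_span // !inE eqxx ?orbT.
by apply: (basis3_of_span bu); apply: span.
Qed.

Lemma basis3_indep u v (a b c : rat) : basis_of {:L} [:: 1; u; v] ->
  a *: 1 + b *: u + c *: v = 0 -> [/\ a = 0, b = 0 & c = 0].
Proof. by move=> /(indep3_basis dimL 1 u v); apply. Qed.

Lemma basis3_notin u v : basis_of {:L} [:: 1; u;
  v] -> u \notin 1%VS /\ v \notin 1%VS.
Proof.
move=> bu; split; apply/negP => /vlineP[a ae].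
  have [|_ /eqP] := @basis3_indep u v (- a) 1 0 bu; last by rewrite oner_eq0.
  by rewrite ae scaleNr !scale0r scale1r addr0 addNr.
have [|_ _ /eqP] := @basis3_indep u v (- a) 0 1 bu; last by rewrite oner_eq0.
by rewrite ae scaleNr !scale0r scale1r addr0 addNr.
Qed.

(** Each move on forms comes from an integral change of (u, v); for the shift, translations by
    integers restore the normalisation that u v is an integer. If a = 0, the table would give u a
    quadratic equation. *)
Lemma ring_form_orbit : cubic_orbit ring_form.
Proof.
split.
- move=> a b c d [u [v [bu [e1 e2 e3]]]]; exists (- v), (- u); split.
    apply: int_basis3_change bu _ _ _ _.
    + by exists 0, 0, (-1); rewrite rmorphN /=; ring.
    + by exists 0, (-1), 0; rewrite rmorphN /=; ring.
    + by exists 0, 0, (-1); rewrite rmorphN /=; ring.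
    + by exists 0, (-1), 0; rewrite rmorphN /=; ring.
  by split; rewrite ?sqrrN ?mulrNN ?(e1, e3) ?(mulrC v) ?e2; ring.
- move=> a b c d [u [v [bu [e1 e2 e3]]]]; exists (- u), (- v); split.
    apply: int_basis3_change bu _ _ _ _.
    + by exists 0, (-1), 0; rewrite rmorphN /=; ring.
    + by exists 0, 0, (-1); rewrite rmorphN /=; ring.
    + by exists 0, (-1), 0; rewrite rmorphN /=; ring.
    + by exists 0, 0, (-1); rewrite rmorphN /=; ring.
  by split; rewrite ?sqrrN ?mulrNN ?(e1, e3) ?e2; ring.
- move=> k a b c d [u [v [bu [e1 e2 e3]]]].
  exists (u + (k * a)%:~R), (v + k%:~R * u - (k * b + k ^+ 2 * a)%:~R); split.
    apply: int_basis3_change bu _ _ _ _.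
    + by exists (k * a), 1, 0; ring.
    + by exists (- (k * b + k ^+ 2 * a)), k, 1; ring.
    + by exists (- (k * a)), 1, 0; ring.
    + by exists (k * b + 2 * k ^+ 2 * a), (- k), 1; ring.
  split; apply/eqP; rewrite -subr_eq0; apply/eqP.
  + transitivity (u ^+ 2 - (- (a * c)%:~R + b%:~R * u - a%:~R * v));
    first by ring.
    by rewrite e1 subrr.
  + transitivity ((u * v + (a * d)%:~R)
      + k%:~R * (u ^+ 2 - (- (a * c)%:~R + b%:~R * u - a%:~R * v)));
        first by ring.
    by rewrite e1 e2 subrr addNr mulr0 addr0.
  + transitivity ((v ^+ 2 - (- (b * d)%:~R + d%:~R * u - c%:~R * v))
      + 2 * k%:~R * (u * v + (a * d)%:~R)
      + k%:~R ^+ 2 * (u ^+ 2 - (- (a * c)%:~R + b%:~R * u - a%:~R * v)));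
        first by ring.
    by rewrite e1 e2 e3 !subrr addNr !mulr0 !addr0.
- move=> a b c d [u [v [[bu _] [e1 _ _]]]]; apply/eqP => a0.
  have [u1 _] := basis3_notin bu.
  have [|_ _ /eqP] := indep3_powers dimL u1 (a := 0) (b := - b%:~R) (c := 1).
    by rewrite e1 a0 !mul0r scale0r scale1r scaleNr scaler_intr; ring.
  by rewrite oner_eq0.
Qed.

Lemma mul_table_cubic u v a b c d : mul_table u v a b c d ->
  u ^+ 3 = b%:~R * u ^+ 2 - (a * c)%:~R * u + (a ^+ 2 * d)%:~R.
Proof.
move=> [e1 e2 _]; apply/eqP; rewrite -subr_eq0; apply/eqP.
transitivity (u * (u ^+ 2 - (- (a * c)%:~R + b%:~R * u - a%:~R * v))
  - a%:~R * (u * v + (a * d)%:~R)); first by ring.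
by rewrite e1 e2 subrr addNr !mulr0 subrr.
Qed.

Lemma mul_table_disc u v a b c d : basis_of {:L} [:: 1; u; v] ->
  mul_table u v a b c d -> disc3 u v = (cubic_disc a b c d)%:~R.
Proof.
move=> bu tab; have [u1 v1] := basis3_notin bu.
have tr u0 v0 a0 b0 c0 d0 : u0 \notin 1%VS -> mul_table u0 v0 a0 b0 c0 d0 ->
    field_trace u0 = b0%:~R.
  move=> nu0 /mul_table_cubic e; apply: (trace_cubic dimL nu0 (e2 := (a0 *
    c0)%:~R) (e3 := (a0 ^+ 2 * d0)%:~R)).
  by rewrite e !scaler_intr mulr1.
have tu := tr _ _ _ _ _ _ u1 tab.
have nv1 : - v \notin 1%VS by rewrite rpredN.
have [e1 e2 e3] := tab.
have tv : field_trace v = - c%:~R.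
  have vN : field_trace (- v) = - field_trace v by rewrite linearN.
  (* The pair (-v, -u) has the swapped table, so the trace of -v is c. *)
  rewrite -[LHS]opprK -vN (tr (- v) (- u) d c b a) //.
  by split; rewrite ?sqrrN ?mulrNN ?(e1, e3) ?(mulrC v) ?e2; ring.
have tz (z : int) : field_trace (z%:~R : L) = 3 * z%:~R.
  by rewrite -[z%:~R]mulr1 -scaler_intr trace_alg dimL; ring.
have tzx (z : int) x : field_trace (z%:~R * x) = z%:~R * field_trace x.
  by rewrite -scaler_intr linearZ.
rewrite disc3E -!expr2 e1 e2 e3 !(linearB, linearD,
  linearN) /= !tzx !tz tu tv /cubic_disc.
by ring.
Qed.

(** Translating u and v by integers makes u v an integer. Comparing u^2 v with u (u v), and v^2 u
    with v (u v), then determines the constant terms of u^2 and v^2. *)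
Lemma ring_form_exists : exists a b c d, ring_form a b c d.
Proof.
have [u [v bu]] := int_basis3_exists.
have [iu iv] := int_basis3_integral bu.
have [_ /(_ (u * v)) /iffLR /(_ (integral_mul iu iv)) [l [m [n uvE]]]] := bu.
have {bu} : int_basis3 (u - n%:~R) (v - m%:~R).
  apply: int_basis3_change bu _ _ _ _.
  - by exists (- n), 1, 0; ring.
  - by exists (- m), 0, 1; ring.
  - by exists n, 1, 0; ring.
  - by exists m, 0, 1; ring.
have : (u - n%:~R) * (v - m%:~R) = (l + m * n)%:~R.
  apply/eqP; rewrite -subr_eq0; apply/eqP.
  by transitivity (u * v - (l%:~R + m%:~R * u + n%:~R * v));
    [ring | rewrite uvE subrr].
move: (u - _) (v - _) (l + _) => {m n uvE iu iv l}u {}v N uvE bu.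
have [iu iv] := int_basis3_integral bu.
have [[i [b [a u2]]] [k [d [c v2]]]] : int_comb u v (u ^+ 2) /\ int_comb u v (v
  ^+ 2).
  by have [_ h] := bu; split; apply/h; apply: integral_mul.
have ind (x y z : int) : x%:~R + y%:~R * u + z%:~R * v = 0 -> [/\ x = 0,
  y = 0 & z = 0].
  move=> h; have [|/eqP x0 /eqP y0 /eqP z0] := @basis3_indep u v x%:~R y%:~R
    z%:~R (proj1 bu).
    by rewrite !scaler_intr mulr1.
  by move: x0 y0 z0; rewrite !intr_eq0 => /eqP-> /eqP-> /eqP->.
have [_ h2 h3] : [/\ b * N + a * k = 0, a * d - N = 0 & i + a * c = 0].
  apply: ind; transitivity (- (u ^+ 2 - (i%:~R + b%:~R * u + a%:~R * v)) * v
    + b%:~R * (N%:~R - u * v) + u * (u * v - N%:~R)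
    + a%:~R * (k%:~R + d%:~R * u + c%:~R * v - v ^+ 2)); first by ring.
  by rewrite u2 v2 uvE !subrr oppr0 !(mul0r, mulr0) !addr0.
have [_ h4 _] : [/\ d * i + c * N = 0, k + d * b = 0 & d * a - N = 0].
  apply: ind; transitivity (- (v ^+ 2 - (k%:~R + d%:~R * u + c%:~R * v)) * u
    + c%:~R * (N%:~R - u * v) + v * (u * v - N%:~R)
    + d%:~R * (i%:~R + b%:~R * u + a%:~R * v - u ^+ 2)); first by ring.
  by rewrite u2 v2 uvE !subrr oppr0 !(mul0r, mulr0) !addr0.
exists (- a), b, (- c), d, u, v; split=> //.
move/eqP: h2; rewrite subr_eq0 => /eqP h2.
have {}h3 : i = - (a * c) by apply/eqP; rewrite -addr_eq0 h3.
have {}h4 : k = - (d * b) by apply/eqP; rewrite -addr_eq0 h4.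
by split; rewrite ?(u2, v2, uvE, h3, h4) -?h2; ring.
Qed.

Lemma ring_form_disc a b c d : ring_form a b c d ->
  field_disc L = (cubic_disc a b c d)%:~R /\ cubic_disc a b c d != 0.
Proof.
move=> [u [v [bu tab]]]; have dE := mul_table_disc (proj1 bu) tab.
rewrite (int_basis3_zbasis bu) dE; split=> //.
by have := disc3_neq0 (proj1 bu); rewrite dE intr_eq0.
Qed.

Lemma ring_form_no_root b c d (x : int) : ring_form 1 b c d ->
  x ^+ 3 - b * x ^+ 2 + c * x - d != 0.
Proof.
move=> [u [v [[bu _] /mul_table_cubic e]]]; apply/negP => /eqP h.
have [u1 _] := basis3_notin bu.
have /eqP : (u - x%:~R) * (u ^+ 2 + (x - b)%:~R * u + (x ^+ 2 - b * x + c)%:~R)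
  = 0.
  transitivity (u ^+ 3 - (b%:~R * u ^+ 2 - (1 * c)%:~R * u + (1 ^+ 2 * d)%:~R)
    - (x ^+ 3 - b * x ^+ 2 + c * x - d)%:~R); first by ring.
  by rewrite e h subrr subr0.
rewrite mulf_eq0 => /orP[|/eqP e0].
  rewrite subr_eq0 => /eqP ux; case/negP: u1.
  by rewrite ux -[_%:~R]mulr1 -scaler_intr rpredZ // mem1v.
have [|_ _ /eqP] := indep3_powers dimL u1 (a := (x ^+ 2 - b * x + c)%:~R)
    (b := (x - b)%:~R) (c := 1); last by rewrite oner_eq0.
by rewrite !scaler_intr scale1r mulr1 -e0; ring.
Qed.

Lemma cubic_field_disc_ge :
  [/\ exists z : int, z != 0 /\ field_disc L = z%:~R, 23 <= `|field_disc L|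
    & `|field_disc L| = 23 ->
      field_disc L = -23 /\ exists be : L, be ^+ 3 = be ^+ 2 - 1].
Proof.
have [a [b [c [d t]]]] := ring_form_exists.
have [dE d0] := ring_form_disc t.
have key : `|cubic_disc a b c d| <= 23 ->
    cubic_disc a b c d = -23 /\ exists be : L, be ^+ 3 = be ^+ 2 - 1.
  move=> le; have [|->[b' [c' [d' [w [[u [v [bu tab]]] rw]]]]]] :=
    small_cubic_orbit ring_form_orbit t _ d0 le.
    by move=> b' c' d' x; apply: ring_form_no_root.
  split=> //; exists (cubic_eval u w); apply: is_K1_rootP rw.
  by rewrite (mul_table_cubic tab); ring.
rewrite dE; split; first by exists (cubic_disc a b c d).
- rewrite -intr_norm (ler_int _ 23) leNgt; apply/negP => lt.
  by have [e _] := key (ltW lt); rewrite e in lt.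
- rewrite -intr_norm => /(@intr_inj _ _ 23) e; have [|-> ?] := key;
  first by rewrite e.
  by [].
Qed.

End CubicIntegralBasis.

(** * The cubic field of discriminant -23 *)

Section CubicFieldMinus23.

Lemma integral_root23 (L : fieldExtType rat) (x : L) :
  x ^+ 3 = x ^+ 2 - 1 -> integralOver (intr : int -> L) x.
Proof.
move=> e; exists (Poly [:: 1; 0; -1; 1]).
  by rewrite monicE /lead_coef (PolyK (c := 0)).
rewrite map_Poly_id0 // rootE horner_Poly /=.
by apply/eqP; rewrite rmorphN /= -[RHS](subrr (x ^+ 3)) {2}e; ring.
Qed.

(** A rational root is integral, hence an integer z, but z^3 - z^2 + 1 is always odd. *)
Lemma no_rational_root (L : fieldExtType rat) (x : L) :
  x ^+ 3 = x ^+ 2 - 1 -> x \notin 1%VS.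
Proof.
move=> e; apply/negP => /vlineP[a xE].
have ix := integral_root23 e; rewrite xE in ix.
have [z zE] := integral_rat ix.
have : z ^+ 3 - z ^+ 2 + 1 = 0.
  apply: (@intr_inj rat); apply: (fmorph_inj (in_alg L)).
  rewrite !rmorphD !rmorphN !rmorphXn !rmorph1 !rmorph0 /= -zE -xE e; ring.
move=> {e ix}; have [z2|z2] : (2 %| z)%Z \/ (2 %| z - 1)%Z by lia.
  by case/dvdzP: z2 => y ->; lia.
by case/dvdzP: z2 => y /eqP; rewrite subr_eq => /eqP ->; lia.
Qed.

(** Here the degree of [L] is not known. In the factorisation r = s q a linear q would make x
    rational, and a linear s would give r a rational root. *)
Lemma adjoin_degree_23 (L : fieldExtType rat) (x : L) :
  x ^+ 3 = x ^+ 2 - 1 -> adjoin_degree 1 x = 3%N.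
Proof.
move=> e; have nx := no_rational_root e.
have [q [mq sq rq qmin]] := rat_minpoly x.
pose r : {poly rat} := Poly [:: 1; 0; -1; 1].
have rE : r = [:: 1; 0; -1; 1] :> seq rat by rewrite (PolyK (c := 0)).
have rr y : (map_poly (in_alg L) r).[y] = y ^+ 3 - y ^+ 2 + 1.
  by rewrite map_Poly_id0 ?rmorph0 // horner_Poly /= !(scale1r, scale0r,
    scaleN1r); ring.
have : q %| r by apply: qmin; apply/rootP; rewrite rr e; ring.
move=> /dvdpP[s sE]; have r0 : r != 0 by rewrite -size_poly_eq0 rE.
have s0 : s != 0 by apply: contraNneq r0 => s0; rewrite sE s0 mul0r.
have q0 : q != 0 by rewrite monic_neq0.
have sz : size r = (size s + size q).-1 by rewrite sE size_mul.
have d1 : adjoin_degree 1 x != 1%N by rewrite adjoin_deg_eq1.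
have s1 : size s != 2%N.
  apply/negP => /eqP s2; have [y ry] : exists y, root s y.
    by have [y] := poly2_root s2; exists y.
  have ry' : root (map_poly (in_alg L) r) (in_alg L y).
    by rewrite fmorph_root sE rootM ry.
  have := no_rational_root (x := in_alg L y); rewrite /= rpredZ ?mem1v // => /(_
    _)/negP[] //.
  move/rootP: ry'; rewrite rr => h; apply/eqP; rewrite -subr_eq0 -h.
  by apply/eqP; rewrite /=; ring.
have : (0 < size s)%N by rewrite lt0n size_poly_eq0.
have : (0 < adjoin_degree 1 x)%N by [].
move: sz d1 s1; rewrite rE sq /=.
by move: (adjoin_degree 1 x) (size s) => d m; lia.
Qed.

Definition rat_eval (L : fieldExtType rat) (x : L) (a b c : rat) : L :=
  in_alg L a + in_alg L b * x + in_alg L c * x ^+ 2.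

Lemma rat_evalM (L : fieldExtType rat) (x : L) a b c a' b' c' : x ^+ 3 = x ^+ 2
  - 1 ->
  rat_eval x a b c * rat_eval x a' b' c' =
    rat_eval x (a * a' - (b * c' + c * b' + c * c'))
      (a * b' + b * a' - c * c')
      (a * c' + b * b' + c * a' + (b * c' + c * b' + c * c')).
Proof.
move=> e; rewrite /rat_eval; apply/eqP; rewrite -subr_eq0; apply/eqP.
transitivity ((x ^+ 3 - (x ^+ 2 - 1)) *
   (in_alg L (b * c' + c * b' + c * c') + in_alg L (c * c') * x));
     first by ring.
by rewrite e subrr mul0r.
Qed.

Lemma rat_eval_inj (L : fieldExtType rat) (x : L) a b c a' b' c' : \dim {:L} =
  3%N ->
  x ^+ 3 = x ^+ 2 - 1 -> rat_eval x a b c = rat_eval x a' b' c' ->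
  [/\ a = a', b = b' & c = c'].
Proof.
move=> dimL e h; have nx := no_rational_root e.
have [|/eqP + /eqP + /eqP] := indep3_powers dimL nx (a := a - a') (b := b - b')
  (c := c - c').
  have alg (r : rat) (z : L) : r *: z = in_alg L r * z by rewrite mulr_algl.
  rewrite (alg _ 1) (alg _ x) (alg _ (x ^+ 2)).
  by rewrite -(subrr (rat_eval x a b c)) {2}h /rat_eval; ring.
by rewrite !subr_eq0 => /eqP-> /eqP-> /eqP->.
Qed.

Lemma rat_evalP (L : fieldExtType rat) (x y : L) : \dim {:L} = 3%N ->
  x ^+ 3 = x ^+ 2 - 1 -> exists abc, y = rat_eval x abc.1.1 abc.1.2 abc.2.
Proof.
move=> dimL e; have nx := no_rational_root e.
have [a [b [c ->]]] := indep3_span dimL y (indep3_powers dimL nx).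
by exists (a, b, c); rewrite /rat_eval /= !mulr_algl.
Qed.

(** Transporting rational coordinates is multiplicative because the product formula [rat_evalM] is
    the same in both fields. *)
Lemma cubic23_iso (K L : fieldExtType rat) (x : K) (y : L) :
    \dim {:K} = 3%N -> \dim {:L} = 3%N ->
  x ^+ 3 = x ^+ 2 - 1 -> y ^+ 3 = y ^+ 2 - 1 -> field_iso K L.
Proof.
move=> dimK dimL ex ey.
have [f fE] := boolp.choice (fun z => rat_evalP z dimK ex).
have [g gE] := boolp.choice (fun z => rat_evalP z dimL ey).
pose F z := rat_eval y (f z).1.1 (f z).1.2 (f z).2.
pose G z := rat_eval x (g z).1.1 (g z).1.2 (g z).2.
have FE a b c : F (rat_eval x a b c) = rat_eval y a b c.
  by have := fE (rat_eval x a b c) => /(rat_eval_inj dimK ex)[h1 h2 h3];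
    rewrite /F -h1 -h2 -h3.
have GE a b c : G (rat_eval y a b c) = rat_eval x a b c.
  by have := gE (rat_eval y a b c) => /(rat_eval_inj dimL ey)[h1 h2 h3];
    rewrite /G -h1 -h2 -h3.
have FB : zmod_morphism F.
  move=> z w; rewrite (fE z) (fE w) !FE.
  set a := _.1.1; set b := _.1.2; set c := _.2.
  rewrite (_ : rat_eval x a b c - _ = rat_eval x (a - (f w).1.1) (b - (f w).1.2)
    (c - (f w).2)).
    by rewrite FE /rat_eval; ring.
  by rewrite /rat_eval; ring.
have FM : monoid_morphism F.
  split; last by move=> z w; rewrite (fE z) (fE w) !FE !rat_evalM // FE.
  rewrite (_ : 1 = rat_eval x 1 0 0) ?FE /rat_eval; by rewrite /= !(scale1r,
    scale0r, mul0r, addr0).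
pose Fa := GRing.isZmodMorphism.Build K L F FB.
pose Fm := GRing.isMonoidMorphism.Build K L F FM.
pose F' : {rmorphism K -> L} := HB.pack F Fa Fm.
exists F'; exists G => z; rewrite /=.
  by rewrite (fE z) FE GE.
by rewrite (gE z) GE FE.
Qed.

(** The order spanned by 1, x, x - x^2 has discriminant -23, which is m^2 times the field
    discriminant. The latter being at least 23 in absolute value, m^2 = 1. *)
Lemma field_disc_23 (K : fieldExtType rat) (x : K) : \dim {:K} = 3%N ->
  x ^+ 3 = x ^+ 2 - 1 -> field_disc K = -23.
Proof.
move=> dimK e; have nx := no_rational_root e.
have bx : basis_of {:K} [:: 1; x; x - x ^+ 2].
  apply: (basis3_of_span dimK (iffLR (indep3_basis dimK _ _ _) (indep3_powers
    dimK nx))).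
    by rewrite memv_span // !inE eqxx orbT.
  rewrite [X in X \in _](_ : _ = x - (x - x ^+ 2)); last by ring.
  by apply: memvB; rewrite memv_span // !inE eqxx ?orbT.
have tab : mul_table x (x - x ^+ 2) 1 1 0 (-1).
  split; first by ring.
    apply/eqP; rewrite -subr_eq0; apply/eqP.
    transitivity (- (x ^+ 3 - (x ^+ 2 - 1))); first by ring.
    by rewrite e subrr oppr0.
  apply/eqP; rewrite -subr_eq0; apply/eqP.
  transitivity ((x ^+ 3 - (x ^+ 2 - 1)) * (x - 1)); first by ring.
  by rewrite e subrr mul0r.
have d23 := mul_table_disc dimK bx tab.
have ix := integral_root23 e.
have ix2 : integralOver (intr : int -> K) (x - x ^+ 2).
  by apply: integral_sub => //; apply: integral_mul.
have [u [v buv]] := int_basis3_exists dimK.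
have [[z [z0 zE]] z23 _] := cubic_field_disc_ge dimK.
have [_ h] := buv; have [[a0 [a1 [a2 xE]]] [b0 [b1 [b2 yE]]]] : int_comb u v x
  /\ int_comb u v (x - x ^+ 2).
  by split; apply/h.
have := disc3_change (u := u) (v := v) (u' := x) (v' := x - x ^+ 2)
  (a0 := a0%:~R) (a1 := a1%:~R) (a2 := a2%:~R) (b0 := b0%:~R) (b1 := b1%:~R) (b2
    := b2%:~R).
rewrite !scaler_intr !mulr1 => /(_ xE yE).
rewrite d23 -(int_basis3_zbasis dimK buv) zE => d.
have {}d : cubic_disc 1 1 0 (-1) = (a1 * b2 - a2 * b1) ^+ 2 * z.
  by apply: (@intr_inj rat); rewrite d; ring.
rewrite (_ : cubic_disc _ _ _ _ = -23) in d; last by vm_compute.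
move: z23; rewrite zE -intr_norm (ler_int _ 23) => z23.
move: d; set m := a1 * b2 - _ => d; rewrite (_ : z = -23) //.
have s1 : m ^+ 2 = 1.
  have s0 := sqr_ge0 m; have := congr1 Num.norm d;
    rewrite normrM (ger0_norm s0).
  move: (m ^+ 2) `|z| s0 z23 => s t; clear; rewrite (_ : `|-23| = 23) // => s0
    t23 e.
  by have : s < 2 /\ 0 < s by [split; nia]; lia.
by rewrite d s1 mul1r.
Qed.

End CubicFieldMinus23.

(** * A curve with torsion Z/2 x Z/12 *)

Notation triple := (int * int * int)%type.

(** The norm of a + b al + c al^2, for al^3 = al^2 - 1; [triple_adj] below is the product of the two
    other conjugates. *)
Definition triple_norm (t : triple) : int :=
  let: (a, b, c) := t in
  a * (a * (a + b + c) + c * (b + c)) + c * (b * (a + b + c) + c * c)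
    - (b + c) * (b * (b + c) - c * a).

Definition triple_adj (t : triple) : triple :=
  let: (a, b, c) := t in
  (a * (a + b + c) + c * (b + c), - (b * (a + b + c) + c * c),
    b * (b + c) - c * a).

Lemma triple_mul_adj t : cubic_mul 1 0 (-1) t (triple_adj t) = (triple_norm t,
  0, 0).
Proof. by case: t => [[a b] c] /=; congr (_, _, _); ring. Qed.

Definition dvd3 (t : triple) := [&& (3 %| t.1.1)%Z,
  (3 %| t.1.2)%Z & (3 %| t.2)%Z].

(* [x^3 - x^2 + 1] is irreducible modulo 3. *)
Lemma dvd3_norm t : (3 %| triple_norm t)%Z -> dvd3 t.
Proof.
case: t => [[a b] c]; rewrite /dvd3 /triple_norm /=.
have r3 (z : int) : exists q r, z = 3 * q + r /\ [|| r == 0, r == 1 | r == 2].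
  by exists (z %/ 3)%Z, (z %% 3)%Z; lia.
have [a' [ra [-> ha]]] := r3 a; have [b' [rb [-> hb]]] := r3 b.
have [c' [rc [-> hc]]] := r3 c => {a b c}.
case/dvdzP=> k; case/or3P: ha => /eqP->; case/or3P: hb => /eqP->;
  case/or3P: hc => /eqP-> => h; lia.
Qed.

(** * Localisation at the prime 3 *)

Section ThreeAdic.
Variables (K : fieldExtType rat) (al : K).
Hypothesis dimK : \dim {:K} = 3%N.
Hypothesis alE : al ^+ 3 = al ^+ 2 - 1.
Local Notation ev := (cubic_eval al).
Local Notation tmul := (cubic_mul 1 0 (-1)).

Lemma evM p q : ev (tmul p q) = ev p * ev q.
Proof. by apply: cubic_evalM; rewrite alE; ring. Qed.

Lemma evD (p q : triple) : ev (p + q) = ev p + ev q.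
Proof. rewrite /cubic_eval /=; ring. Qed.

Lemma evN (p : triple) : ev (- p) = - ev p.
Proof. rewrite /cubic_eval /=; ring. Qed.

Lemma ev_int (n : int) : ev (n, 0, 0) = n%:~R.
Proof. rewrite /cubic_eval /=; ring. Qed.

Lemma ev_scale (n : int) t : ev (n * t.1.1, n * t.1.2, n * t.2) = n%:~R * ev t.
Proof. rewrite /cubic_eval /=; ring. Qed.

Lemma ev_inj : injective ev.
Proof.
move=> [[a b] c] [[a' b'] c'] h.
have [|/eqP + /eqP + /eqP] := indep3_powers dimK (no_rational_root alE)
  (a := (a - a')%:~R) (b := (b - b')%:~R) (c := (c - c')%:~R).
  rewrite !scaler_intr -(subrr (ev (a, b, c))) {2}h /cubic_eval /=; ring.
by rewrite !intr_eq0 !subr_eq0 => /eqP-> /eqP-> /eqP->.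
Qed.

Lemma intrK_eq0 (z : int) : ((z%:~R : K) == 0) = (z == 0).
Proof. by rewrite -scaler_int scaler_eq0 oner_eq0 orbF intr_eq0. Qed.

Lemma ev_den (x : K) : exists n t, (0 < n)%N /\ n%:R * x = ev t.
Proof.
have [[[a b] c] /= ->] := rat_evalP x dimK alE.
exists (absz (denq a * denq b * denq c)).
exists (numq a * (denq b * denq c), numq b * (denq a * denq c),
  numq c * (denq a * denq b)).
split; first by rewrite absz_gt0 !mulf_neq0.
have -> : (absz (denq a * denq b * denq c))%:R = ((denq a * denq b * denq c)%:~R
  : K).
  by rewrite pmulrn gez0_abs // !mulr_ge0.
have nq (r : rat) : in_alg K r = (numq r)%:~R / (denq r)%:~R.
  rewrite -[r in LHS]divq_num_den fmorph_div !rmorph_int //.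
rewrite /rat_eval !nq /cubic_eval /=; field; rewrite !intrK_eq0 !denq_neq0 //.
Qed.

(* The localisation at the inert prime 3. *)
Definition int3 : {pred K} := fun x =>
  boolp.asbool (exists (m : int) (t : triple),
    ~~ (3 %| m)%Z /\ m%:~R * x = ev t).

Lemma int3P x : reflect (exists (m : int) (t : triple),
  ~~ (3 %| m)%Z /\ m%:~R * x = ev t) (x \in int3).
Proof. exact: boolp.asboolP. Qed.

Lemma int3_ev t : ev t \in int3.
Proof. by apply/int3P; exists 1, t; rewrite mul1r. Qed.

Lemma ndvd3M (m n : int) : ~~ (3 %| m)%Z -> ~~ (3 %| n)%Z -> ~~ (3 %| m * n)%Z.
Proof. by move=> hm hn; rewrite !dvdzE abszM Euclid_dvdM // negb_or -!dvdzE hm.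
  Qed.

Lemma int3_subring : subring_closed int3.
Proof.
split; first by rewrite -[1](ev_int 1) int3_ev.
- move=> x y /int3P[m [t [m3 mx]]] /int3P[n [s [n3 ny]]]; apply/int3P.
  exists (m * n), ((n * t.1.1, n * t.1.2, n * t.2) - (m * s.1.1, m * s.1.2,
    m * s.2)).
  by rewrite ndvd3M // evD evN !ev_scale -mx -ny; split=> //; ring.
- move=> x y /int3P[m [t [m3 mx]]] /int3P[n [s [n3 ny]]]; apply/int3P.
  by exists (m * n), (tmul t s); rewrite ndvd3M // evM -mx -ny; split=> //;
    ring.
Qed.

HB.instance Definition _ := GRing.isSubringClosed.Build K int3 int3_subring.

Local Notation M := (val_ge int3 3).

Let n3_neq0 : (3%:R : K) != 0.
Proof. by rewrite (intrK_eq0 3). Qed.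

Lemma val_ge_dvd k t : M k (ev t) ->
  [/\ ((3 ^ k)%N%:Z %| t.1.1)%Z, ((3 ^ k)%N%:Z %| t.1.2)%Z & ((3 ^ k)%N%:Z %|
    t.2)%Z].
Proof.
move=> /int3P[m [s [m3 ms]]].
have : ev (m * t.1.1, m * t.1.2, m * t.2)
     = ev ((3 ^ k)%N%:Z * s.1.1, (3 ^ k)%N%:Z * s.1.2, (3 ^ k)%N%:Z * s.2).
  rewrite !ev_scale -ms -pmulrn natrX; field.
  by rewrite expf_neq0.
have cop : coprimez (3 ^ k)%N m.
  by rewrite coprimezE /= coprimeXl // prime_coprime // -dvdzE.
move/ev_inj => [h0 h1 h2].
by split; rewrite -(Gauss_dvdzr _ cop) ?(h0, h1, h2) dvdz_mulr.
Qed.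

Lemma val_ge1_ev t : M 1 (ev t) = dvd3 t.
Proof.
apply/idP/idP => [/val_ge_dvd[]|]; first by rewrite /dvd3 expn1 => -> -> ->.
case: t => [[a b] c] /and3P[/= /dvdzP[a' ->] /dvdzP[b' ->] /dvdzP[c' ->]].
suff vE : ev (a' * 3, b' * 3, c' * 3) / 3%:R ^+ 1 = ev (a', b', c').
  by rewrite /val_ge vE; apply: int3_ev.
rewrite expr1; apply: (canLR (mulfK n3_neq0)); rewrite /cubic_eval /=.
by ring.
Qed.

Lemma inv3_notin : (3%:R : K)^-1 \notin int3.
Proof.
apply/int3P => -[m [t [m3 mt]]]; case/negP: m3.
have : ev (m, 0, 0) = ev (3 * t.1.1, 3 * t.1.2, 3 * t.2).
  by rewrite ev_int ev_scale -mt; field.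
by move=> /ev_inj[-> _ _]; rewrite dvdz_mulr.
Qed.

Lemma dvd3_intP (n : nat) : ~~ (3 %| n)%N -> ~~ (3 %| n%:Z)%Z.
Proof. by rewrite dvdzE. Qed.

Lemma triple_norm_unit t : ~~ dvd3 t -> ~~ (3 %| triple_norm t)%Z.
Proof. by apply: contra => /dvd3_norm. Qed.

(** Write x = t / n with n minimal. If 3 divided t, either n could be divided by 3 or x would have
    positive order. So the norm of t is prime to 3 and serves as a denominator of n / t. *)
Lemma int3_inv (x : K) : ~~ M 1 x -> x^-1 \in int3.
Proof.
move=> xM; pose P n := (0 < n)%N && boolp.asbool (exists t, n%:R * x = ev t).
have exP : exists n, P n.
  have [n [t [n0 nt]]] := ev_den x; exists n; rewrite /P n0.
  by apply/boolp.asboolP; exists t.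
case: (ex_minnP exP) => n /andP[n0 /boolp.asboolP[t nt]] nmin.
have n0K : (n%:R : K) != 0 by rewrite pmulrn intrK_eq0 eqz_nat -lt0n.
have t3 : ~~ dvd3 t.
  apply/negP => t3; have [n3|n3] := boolP (3 %| n)%N.
    case/dvdnP: n3 => k nE.
    case: (t) t3 nt => [[a b] c] /and3P[/= /dvdzP[a' ->] /dvdzP[b' ->] /dvdzP[c'
      ->]] nt.
    have k0 : (0 < k)%N by move: n0; rewrite nE muln_gt0 => /andP[].
    have : P k.
      rewrite /P k0; apply/boolp.asboolP; exists (a', b', c');
        apply: (mulfI n3_neq0).
      rewrite mulrA -natrM mulnC -nE nt /cubic_eval /=; ring.
    by move/nmin; rewrite nE; lia.
  case/negP: xM; rewrite /val_ge.
  case: (t) t3 nt => [[a b] c] /and3P[/= /dvdzP[a' ->] /dvdzP[b' ->] /dvdzP[c'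
    ->]] nt.
  apply/int3P; exists n%:Z, (a', b', c'); split; first exact: dvd3_intP.
  apply: (mulfI n3_neq0); transitivity (n%:R * x);
    first by rewrite expr1 -pmulrn; field.
  by rewrite nt /cubic_eval /=; ring.
have t0 : triple_norm t != 0.
  by apply: contra (triple_norm_unit t3) => /eqP ->; rewrite dvdz0.
have etn : ev t * ev (triple_adj t) = (triple_norm t)%:~R.
  by rewrite -evM triple_mul_adj ev_int.
have x0 : x != 0 by apply: contra xM => /eqP ->; rewrite /val_ge mul0r rpred0.
apply/int3P; exists (triple_norm t), (tmul (n%:Z, 0, 0) (triple_adj t)).
split; first exact: triple_norm_unit.
by rewrite evM ev_int -etn -nt -pmulrn; field.
Qed.

Lemma int3_sep (x : K) : x != 0 -> exists k, ~~ M k x.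
Proof.
move=> x0; have [n [t [n0 nt]]] := ev_den x.
have n0K : (n%:R : K) != 0 by rewrite pmulrn intrK_eq0 eqz_nat -lt0n.
(* N < 3^N, and N bounds each coordinate, so a coordinate divisible by 3^N is zero. *)
pose N := (absz t.1.1 + absz t.1.2 + absz t.2)%N.
have t0 : (0 < N)%N.
  rewrite lt0n; apply/negP; rewrite /N !addn_eq0 !absz_eq0 => /andP[/andP[/eqP
    a0 /eqP b0] /eqP c0].
  have : n%:R * x != 0 by rewrite mulf_neq0.
  by rewrite nt /cubic_eval a0 b0 c0; move=> /eqP[]; ring.
exists N; apply/negP => xM; have : M N (ev t).
  by rewrite -nt /val_ge -mulrA rpredM // rpred_nat.
case/val_ge_dvd; rewrite !dvdzE /= => h0 h1 h2.
have lt : (N < 3 ^ N)%N by apply: ltn_expl.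
have small a : (3 ^ N %| a)%N -> (a <= N)%N -> a = 0%N.
  by move=> d le; apply/eqP; rewrite -leqn0 leqNgt;
    apply/negP => /dvdn_leq/(_ d); lia.
have := small _ h0; have := small _ h1; have := small _ h2; rewrite /N in t0 *;
  lia.
Qed.

Definition digits : seq int := [:: 0; 1; 2].

Definition residues : seq triple :=
  [seq (p.1, p.2, c) | p <- [seq (a, b) | a <- digits, b <- digits],
    c <- digits].

Lemma modz3_digit (z : int) : (z %% 3)%Z \in digits.
Proof.
have ge0 : (0 <= z %% 3)%Z by lia.
have lt3 : ((z %% 3)%Z < 3) by lia.
by move: (z %% 3)%Z ge0 lt3 => r; rewrite !inE; lia.
Qed.

Lemma mem_residues a b c : a \in digits -> b \in digits -> c \in digits ->
  (a, b, c) \in residues.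
Proof. by rewrite !inE => /or3P[]/eqP-> /or3P[]/eqP-> /or3P[]/eqP->. Qed.

Lemma int3_residue x : x \in int3 -> exists2 r, r \in residues & M 1 (x - ev r).
Proof.
move=> /int3P[m [[[a b] c] [m3 mx]]].
exists ((m * a %% 3)%Z, (m * b %% 3)%Z, (m * c %% 3)%Z).
  by rewrite mem_residues ?modz3_digit.
(* Modulo 3 the denominator m is its own inverse, so x is congruent to m (m x). *)
have [q qE] : exists q, m * m = 1 + 3 * q.
  exists ((m * m - 1) %/ 3)%Z.
  have [[y ->]|[y ->]] : (exists y, m = 1 + 3 * y) \/ (exists y, m = 2 + 3 * y).
  - have [e|e] : (m %% 3)%Z = 1 \/ (m %% 3)%Z = 2 by lia.
      by left; exists (m %/ 3)%Z; lia.
    by right; exists (m %/ 3)%Z; lia.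
  - rewrite (_ : _ - 1 = (2 * y + 3 * y * y) * 3); last by ring.
    by rewrite mulzK //; ring.
  - rewrite (_ : _ - 1 = (1 + 4 * y + 3 * y * y) * 3); last by ring.
    by rewrite mulzK //; ring.
have dE (z : int) : (z %% 3)%Z = z - 3 * (z %/ 3)%Z by lia.
pose w : triple := ((m * a %/ 3)%Z, (m * b %/ 3)%Z, (m * c %/ 3)%Z).
have -> : ev ((m * a %% 3)%Z, (m * b %% 3)%Z, (m * c %% 3)%Z)
    = m%:~R * ev (a, b, c) - 3 * ev w.
  by rewrite !dE /cubic_eval /=; ring.
apply/int3P; exists m, (- (q * a, q * b, q * c) + (m * w.1.1, m * w.1.2,
  m * w.2)).
split=> //; apply: (mulfI n3_neq0).
rewrite evD evN !(ev_scale _ (a, b, c)) (ev_scale _ w) -mx.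
have mK : (m%:~R : K) * m%:~R = 1 + 3 * q%:~R by rewrite -rmorphM qE; ring.
transitivity (m%:~R * (x - m%:~R * m%:~R * x + 3 * ev w)).
  by rewrite expr1; field.
by rewrite mK; ring.
Qed.

(* The coefficients come from a search among the curves in Tate normal form
   with a point of order 12; the reduction at the inert prime 3 is good. *)
Definition curve_a2 : triple := (19, -17, -3).
Definition curve_a4 : triple := (0, -64, 16).

Definition curve_weq : weierstrass K := Weierstrass 0 (ev curve_a2) 0 (ev
  curve_a4) 0.

Lemma ev_neq0 t : t != 0 -> ev t != 0.
Proof.
by apply: contra => /eqP h; apply/eqP/ev_inj; rewrite h /cubic_eval /=; ring.
Qed.

Lemma ev_root_disc : ev curve_a2 ^+ 2 - 4 * ev curve_a4 = ev (250, -399, 222).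
Proof.
have -> : ev curve_a2 ^+ 2 - 4 * ev curve_a4
    = ev (tmul curve_a2 curve_a2 - (4 * curve_a4.1.1, 4 * curve_a4.1.2,
      4 * curve_a4.2)).
  by rewrite evD evN evM ev_scale expr2.
by congr ev; vm_compute.
Qed.

Fact curve_smooth : wdisc curve_weq != 0.
Proof.
rewrite (_ : wdisc _ = 16 * ev curve_a4 ^+ 2 * (ev curve_a2 ^+ 2 - 4 * ev
  curve_a4)).
  rewrite ev_root_disc !mulf_neq0 ?expf_neq0 ?ev_neq0 //.
  by rewrite (intrK_eq0 16).
by rewrite /wdisc /wb2 /wb4 /wb6 /wb8 /=; ring.
Qed.

Definition curve : elliptic_curve K := EllipticCurve curve_smooth.

Definition tcurve (x y : triple) : triple :=
  tmul y y - tmul x (tmul x (x + curve_a2) + curve_a4).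

Lemma ev_tcurve x y : ev (tcurve x y)
  = ev y ^+ 2 - (ev x ^+ 3 + ev curve_a2 * ev x ^+ 2 + ev curve_a4 * ev x).
Proof. by rewrite /tcurve evD evN !evM evD evM evD; ring. Qed.

Lemma on_curveE x y : on_curve curve (Some (x, y))
  = (y ^+ 2 - (x ^+ 3 + ev curve_a2 * x ^+ 2 + ev curve_a4 * x) == 0).
Proof. by rewrite /= subr_eq0 !mul0r !addr0. Qed.

Lemma on_curve_ev x y : tcurve x y == 0 -> on_curve curve (Some (ev x, ev y)).
Proof. by move=> /eqP h; rewrite on_curveE -ev_tcurve h /cubic_eval /=;
  apply/eqP; ring. Qed.

(** Supplying the line as integral triples turns an addition of points into Vieta identities between
    integers, decided by computation without division. *)
Lemma point_add_ev (l n x1 y1 x2 y2 x3 y3 : triple) (P Q : point curve) :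
    val P = Some (ev x1, ev y1) -> val Q = Some (ev x2, ev y2) ->
    [&& x1 + x2 + x3 == tmul l l - curve_a2,
        tmul x1 x2 + tmul x1 x3 + tmul x2 x3 == curve_a4 - tmul l n - tmul l n,
        tmul (tmul x1 x2) x3 == tmul n n, y1 == tmul l x1 + n,
          y2 == tmul l x2 + n
      & y3 == - (tmul l x3 + n)] ->
  val (P + Q) = Some (ev x3, ev y3).
Proof.
move=> eP eQ /and5P[/eqP h1 /eqP h2 /eqP h3 /eqP e1 /andP[/eqP e2 /eqP e3]].
rewrite -[val (P + Q)]/(add_coord curve (val P) (val Q)) eP eQ e1 e2 e3 evN !evD
  !evM.
have cut : line_cut curve (ev l) (ev n) (ev x1) (ev x2) (ev x3).
  split; rewrite /= !mul0r.
  - by rewrite -!evD h1 evD evN evM; ring.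
  - by rewrite -!evM -!evD h2 !evD !evN evM; ring.
  - by rewrite -!evM h3 evM; ring.
rewrite (cut_add_coord curve_smooth cut) /oppy /=.
by congr (Some (_, _)); ring.
Qed.

Definition gen12 : triple * triple := ((-12, 12, -4), (-16, 28, -20)).
Definition gen2 : triple * triple := ((-16, 16, 0), 0).

Fact gen12_on : on_curve curve (Some (ev gen12.1, ev gen12.2)).
Proof. by apply: on_curve_ev; vm_compute. Qed.

Fact gen2_on : on_curve curve (Some (ev gen2.1, ev gen2.2)).
Proof. by apply: on_curve_ev; vm_compute. Qed.

Definition point12 : point curve :=
  exist (fun P : option (K * K) => is_true (on_curve curve P)) _ gen12_on.
Definition point2 : point curve :=
  exist (fun P : option (K * K) => is_true (on_curve curve P)) _ gen2_on.

Lemma val_2point12 : val (point12 *+ 2) = Some (ev (4, -16, 16), ev (80, -96,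
  68)).
Proof.
rewrite mulr2n; apply: (@point_add_ev (-2, 2, 1) (gen12.2 - tmul (-2, 2,
  1) gen12.1));
  by [|vm_compute].
Qed.

Lemma val_4point12 : val (point12 *+ 4) = Some (ev (0, 0, 4), ev (12, -4, 4)).
Proof.
rewrite -[4%N]/(2 * 2)%N mulrnA mulr2n.
by apply: (@point_add_ev (4, -6, 1) ((80, -96, 68) - tmul (4, -6, 1) (4, -16,
  16)) _ _ _ _ _ _ _ _ val_2point12 val_2point12);
  vm_compute.
Qed.

Lemma val_6point12 : val (point12 *+ 6) = Some (ev 0, ev 0).
Proof.
rewrite -[6%N]/(4 + 2)%N mulrnDr.
by apply: (@point_add_ev (4, -4, 1) ((12, -4, 4) - tmul (4, -4, 1) (0, 0,
  4)) _ _ _ _ _ _ _ _ val_4point12 val_2point12);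
  vm_compute.
Qed.

Lemma point_2torsion (P : point curve) x : val P = Some (x, 0) -> P *+ 2 = 0.
Proof.
move=> eP; apply/eqP; rewrite mulr2n addr_eq0; apply/eqP; apply: val_inj.
rewrite -[val (- P)]/(opp_coord curve (val P)) eP /opp_coord /oppy.
by rewrite -[wa1 _]/(0 : K) -[wa3 _]/(0 : K) mul0r !oppr0 !addr0.
Qed.

Lemma ev0 : ev 0 = 0.
Proof. rewrite /cubic_eval /=; ring. Qed.

Lemma point12_12 : point12 *+ 12 = 0.
Proof.
rewrite -[12%N]/(6 * 2)%N mulrnA; apply: (@point_2torsion _ (ev 0)).
by rewrite val_6point12 ev0.
Qed.

Lemma point2_2 : point2 *+ 2 = 0.
Proof. by apply: (@point_2torsion _ (ev gen2.1)); rewrite /= ev0. Qed.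

(** Every proper divisor of 12 divides 4 or 6, so it suffices that the multiples by 4 and 6 are
    nonzero. *)
Lemma point12_order j : (point12 *+ j == 0) = (12 %| j)%N.
Proof.
apply/idP/idP => [/eqP j0|/dvdnP[k ->]]; last by rewrite mulnC mulrnA point12_12
  mul0rn.
have g0 : point12 *+ gcdn j 12 = 0.
  have [->|jp] := posnP j; first by rewrite gcd0n point12_12.
  have [u v uv _] := egcdnP 12 jp.
  have := congr1 (fun n => point12 *+ n) uv.
  by rewrite mulrnDr (mulnC u) (mulnC v) !mulrnA j0 point12_12 !mul0rn add0r =>
    <-.
have p4 : point12 *+ 4 != 0.
  by apply/negP => /eqP h; have := val_4point12; rewrite h.
have p6 : point12 *+ 6 != 0.
  by apply/negP => /eqP h; have := val_6point12; rewrite h.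
have : gcdn j 12 \in divisors 12 by rewrite -dvdn_divisors // dvdn_gcdr.
have [e|n12] := eqVneq (gcdn j 12) 12%N; first by move=> _;
  rewrite -e dvdn_gcdl.
have kill d : (gcdn j 12 %| d)%N -> point12 *+ d = 0.
  by case/dvdnP => k ->; rewrite mulnC mulrnA g0 mul0rn.
move=> gd; have : (gcdn j 12 %| 4)%N || (gcdn j 12 %| 6)%N.
  by move: (gcdn j 12) n12 gd => g n12; rewrite !inE (negPf n12) orbF =>
    /or4P[|||/orP[]] /eqP->.
by case/orP => /kill h; [rewrite h eqxx in p4 | rewrite h eqxx in p6].
Qed.

(** If y and the derivative vanish modulo 3, then x = 0 modulo 3 would force a4 = 0, and otherwise x
    is a double root of X^2 + a2 X + a4. Both a4 and the discriminant a2^2 - 4 a4 are units at 3. *)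
Lemma good_reduction x y : on_curve curve (Some (x, y)) -> x \in int3 ->
  M 1 y -> ~~ M 1 (3 * x ^+ 2 + 2 * wa2 curve * x + wa4 curve).
Proof.
rewrite on_curveE subr_eq0 => /eqP c xO yM; apply/negP => dM.
have cM : M 1 (x * (x ^+ 2 + ev curve_a2 * x + ev curve_a4)).
  rewrite (_ : _ * _ = y ^+ 2); last by rewrite c; ring.
  by rewrite expr2; exact: (val_geMl inv3_notin (val_ge_int inv3_notin yM) yM).
have a4u : ~~ M 1 (ev curve_a4) by rewrite val_ge1_ev.
have nx : ~~ M 1 x.
  apply: contra a4u => xM; have -> : ev curve_a4
      = (3 * x ^+ 2 + 2 * wa2 curve * x + wa4 curve) - x * (3 * x + 2 * ev
        curve_a2).
    by rewrite /=; ring.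
  apply: val_geB => //; apply: (val_geMr inv3_notin) => //.
  by rewrite rpredD // rpredM ?rpred_nat ?int3_ev.
have gM : M 1 (x ^+ 2 + ev curve_a2 * x + ev curve_a4).
  by apply: (val_ge_unit inv3_notin int3_inv nx xO); rewrite mulrC.
have lM : M 1 (2 * x + ev curve_a2).
  apply: (val_ge_unit inv3_notin int3_inv nx xO);
    rewrite (_ : _ * x = (3 * x ^+ 2 + 2 * wa2 curve * x + wa4 curve) -
    (x ^+ 2 + ev curve_a2 * x + ev curve_a4)); last by rewrite /=; ring.
  exact: val_geB.
have : ~~ M 1 (ev (250, -399, 222)) by rewrite val_ge1_ev.
rewrite -ev_root_disc (_ : _ - _ = (2 * x + ev curve_a2) * (2 * x + ev curve_a2)
   - 4 * (x ^+ 2 + ev curve_a2 * x + ev curve_a4)); last by ring.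
case/negP; apply: val_geB; apply: (val_geMl inv3_notin) => //;
  last exact: rpred_nat.
by rewrite rpredD ?int3_ev // rpredM ?rpred_nat.
Qed.

Lemma two_unit : ~~ M 1 2.
Proof. by rewrite -[2](ev_int 2) val_ge1_ev. Qed.

Lemma zero_int3 : 0 \in int3.
Proof. exact: rpred0. Qed.

Lemma curve_torsion_integral (P : point curve) x y : is_torsion P ->
  val P = Some (x, y) -> x \in int3 /\ y \in int3.
Proof.
apply: (torsion_integral (E := curve) (p := 3) isT inv3_notin int3_inv int3_sep
  erefl erefl);
  rewrite ?int3_ev //; exact: zero_int3.
Qed.

Lemma curve_torsion_inj (P Q : point curve) x1 y1 x2 y2 :
    is_torsion P -> is_torsion Q ->
    val P = Some (x1, y1) -> val Q = Some (x2, y2) ->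
  M 1 (x1 - x2) -> M 1 (y1 - y2) -> P = Q.
Proof.
apply: (torsion_red_inj (E := curve) (p := 3) isT inv3_notin int3_inv int3_sep
  erefl erefl);
  rewrite ?int3_ev //; [exact: zero_int3 | exact: two_unit | exact:
    good_reduction].
Qed.

(** * Counting torsion through the residue field *)

Definition residue_points : seq (triple * triple) :=
  [seq c <- [seq (r, s) | r <- residues, s <- residues] | dvd3 (tcurve c.1
    c.2)].

(** These are the affine points; the 24th point is at infinity. *)
Lemma size_residue_points : size residue_points = 23%N.
Proof. by vm_compute. Qed.

Definition reduces_to (P : point curve) (c : triple * triple) :=
  exists x y, [/\ val P = Some (x, y), M 1 (x - ev c.1) & M 1 (y - ev c.2)].

Lemma reduces_to_inj (P Q : point curve) c : is_torsion P -> is_torsion Q ->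
  reduces_to P c -> reduces_to Q c -> P = Q.
Proof.
move=> tP tQ [x1 [y1 [eP xP yP]]] [x2 [y2 [eQ xQ yQ]]].
apply: (curve_torsion_inj tP tQ eP eQ).
  rewrite (_ : x1 - x2 = (x1 - ev c.1) - (x2 - ev c.1)); last by ring.
  exact: val_geB.
rewrite (_ : y1 - y2 = (y1 - ev c.2) - (y2 - ev c.2)); last by ring.
exact: val_geB.
Qed.

Lemma reduces_to_exists (P : point curve) : is_torsion P -> P != 0 ->
  exists2 c, c \in residue_points & reduces_to P c.
Proof.
move=> tP P0; case eP: (val P) => [[x y]|]; last first.
  by case/eqP: P0; apply: val_inj; rewrite eP.
have [xO yO] := curve_torsion_integral tP eP.
have [r rr xr] := int3_residue xO; have [s sr ys] := int3_residue yO.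
exists (r, s); last by exists x, y.
rewrite mem_filter allpairs_f // andbT -val_ge1_ev ev_tcurve.
have := valP P; rewrite eP on_curveE => /eqP c.
rewrite -[X in M 1 X]subr0 -{}c.
rewrite (_ : _ - _ = (x - ev r) * (x ^+ 2 + x * ev r + ev r ^+ 2
    + ev curve_a2 * (x + ev r) + ev curve_a4) - (y - ev s) * (y + ev s));
      last by ring.
have [rO sO] := (int3_ev r, int3_ev s).
apply: val_geB; apply: (val_geMr inv3_notin) => //; last exact: rpredD.
apply: rpredD; last exact: int3_ev.
apply: rpredD; last by rewrite rpredM ?int3_ev // rpredD.
by rewrite !rpredD ?rpredX // rpredM.
Qed.

Lemma mulrn_modn (V : zmodType) (x : V) d n : x *+ d = 0 -> x *+ (n %% d) = x *+
  n.
Proof.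
by move=> xd; rewrite {2}(divn_eq n d) mulrnDr mulnC mulrnA xd mul0rn add0r.
Qed.

Definition torsion_map (g : 'Z_2 * 'Z_12) : point curve :=
  point2 *+ g.1 + point12 *+ g.2.

Lemma torsion_mapD : {morph torsion_map : g h / g + h >-> point_add g h}.
Proof.
move=> g h; rewrite point_addE /torsion_map /= (mulrn_modn _ point2_2).
by rewrite (mulrn_modn _ point12_12) !mulrnDr addrACA.
Qed.

Lemma torsion_map_torsion g : is_torsion (torsion_map g).
Proof.
apply/is_torsionE; exists 12%N => //.
rewrite mulrnDl -!mulrnA !(mulnC _ 12%N) !mulrnA point12_12 mul0rn addr0.
by rewrite -[12%N]/(2 * 6)%N mulrnA point2_2 !mul0rn.
Qed.

(** Doubling removes [point2] and leaves 6 | j. For i = 1, either [point2] would be zero or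
    [point12 *+ 6], which is (0, 0), would be the opposite of [point2], whose abscissa is
    nonzero. *)
Lemma torsion_map_ker g : torsion_map g = 0 -> g = 0.
Proof.
case: g => i j; rewrite /torsion_map /= => h.
have j6 : (6 %| j)%N.
  have := congr1 (fun P => P *+ 2) h; rewrite mulrnDl mul0rn (mulrnAC point2).
  rewrite point2_2 mul0rn add0r -mulrnA => /eqP; rewrite point12_order.
  by rewrite -[12%N]/(6 * 2)%N dvdn_pmul2r.
have i0 : i = 0.
  case: i h => -[|[|//]] lt h; first exact: val_inj.
  rewrite mulr1n in h; case/dvdnP: j6 => k kE; have : (k < 2)%N.
    by rewrite -(ltn_pmul2r (isT : 0 < 6)%N) -kE; exact: ltn_ord.
  case: k kE => [|[|//]] kE _; rewrite kE in h.
    by rewrite addr0 in h; have := congr1 val h.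
  have := congr1 val h; rewrite mul1n => h'.
  have /(congr1 val) : point12 *+ 6 = - point2 by apply/eqP;
    rewrite -addr_eq0 addrC h.
  rewrite val_6point12 => -[] /ev_inj; discriminate.
move: h; rewrite i0 mulr0n add0r => /eqP; rewrite point12_order => j12.
congr (_, _); apply: val_inj => /=; apply/eqP; rewrite -leqn0 leqNgt;
  apply/negP => j0.
by have := dvdn_leq j0 j12; rewrite leqNgt ltn_ord.
Qed.

Lemma torsion_map_inj : injective torsion_map.
Proof.
move=> g h e; apply/eqP; rewrite -subr_eq0; apply/eqP; apply: torsion_map_ker.
apply: (addIr (torsion_map h)); rewrite add0r -point_addE -torsion_mapD.
by rewrite subrK.
Qed.

(* The curve has 24 points over the field of 27 elements, so the reduction
   map, injective on torsion, leaves no room for further torsion. *)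
Lemma torsion_map_surj (P : point curve) : is_torsion P -> exists g,
  torsion_map g = P.
Proof.
move=> tP; have [->|P0] := eqVneq P 0.
  by exists 0; rewrite /torsion_map /= !mulr0n addr0.
have ex (g : 'Z_2 * 'Z_12) : exists c, g != 0 -> c \in residue_points
  /\ reduces_to (torsion_map g) c.
  have [->|g0] := eqVneq g 0; first by exists 0.
  have [|c cr cc] := reduces_to_exists (torsion_map_torsion g);
    last by exists c.
  by apply: contra g0 => /eqP /torsion_map_ker ->.
have [code codeP] := fin_all_exists ex.
have [c cr cc] := reduces_to_exists tP P0.
(* The 23 nonzero elements of the group inject into the 23 affine residue points, so P has the same
   reduction as one of their images. *)
pose nz := enum (predC1 (0 : 'Z_2 * 'Z_12)).
have inz g : g \in nz -> g != 0 by rewrite mem_enum.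
have unz : uniq (map code nz).
  rewrite map_inj_in_uniq ?enum_uniq // => g h /inz g0 /inz h0 e.
  have [_ rg] := codeP g g0; have [_ rh] := codeP h h0; rewrite -e in rh.
  apply: torsion_map_inj; exact: reduces_to_inj (torsion_map_torsion g)
    (torsion_map_torsion h) rg rh.
have sub : {subset map code nz <= residue_points}.
  by move=> _ /mapP[g /inz g0 ->]; have [] := codeP g g0.
have sz : (size residue_points <= size (map code nz))%N.
  by rewrite size_residue_points size_map -cardE cardC1 card_prod !card_ord.
have [_ mem] := uniq_min_size unz sub sz.
move: cr; rewrite -mem => /mapP[g /inz g0 cE].
exists g; have [_ rg] := codeP g g0; rewrite -cE in rg.
exact: reduces_to_inj (torsion_map_torsion g) tP rg cc.
Qed.

Lemma cubic_with_Z2Z12 : cubic_with_torsion ('Z_2 * 'Z_12)%type K.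
Proof.
split=> //; exists curve, torsion_map; split.
- exact: torsion_map_inj.
- exact: torsion_mapD.
- move=> P; split; first exact: torsion_map_surj.
  by move=> [g <-]; apply: torsion_map_torsion.
Qed.

End ThreeAdic.

Theorem proposition6 (K1 : fieldExtType rat) (alpha1 : K1)
    (h_root : root ('X^3 - 'X^2 + 1 : {poly K1}) alpha1)
    (h_gen : <<1; alpha1>>%VS = {:K1}%VS) :
  is_M ('Z_2 * 'Z_12)%type K1 /\ field_disc K1 = -23.
Proof.
have alE : alpha1 ^+ 3 = alpha1 ^+ 2 - 1.
  move/rootP: h_root; rewrite !hornerE => h.
  by apply/eqP; rewrite -subr_eq0 -h; apply/eqP; ring.
have dimK : \dim {:K1} = 3%N.
  by rewrite -h_gen dim_Fadjoin dimv1 muln1 (adjoin_degree_23 alE).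
have disc := field_disc_23 dimK alE.
split=> //; split; first exact: cubic_with_Z2Z12 dimK alE.
move=> L [dimL _]; have [_ ge23 eq23] := cubic_field_disc_ge dimL.
rewrite disc normrN; split=> // /eq23[_ [be beE]].
exact: cubic23_iso dimK dimL alE beE.
Qed.
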